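(* There is an absolute constant $C>0$ such that the following holds. Let $(a,b)$ be the $SU(2)$-valued nonlinear Fourier transform of a sequence $F\in\ell^2(\mathbb{Z})$ such that $a^*$ is outer in $\mathbb{D}$. Let $w$ be a strong Beurling weight, let $\varepsilon>0$, and assume $\|b\|_{A_w}<\frac{1}{\sqrt2}-\varepsilon$. Then $$\|F\|_{\ell^1_w}\le\frac{C}{\varepsilon}\,\|b/a\|_{A_w}.$$
   Context: Notation. $\mathbb{T}$ is the unit circle, $\mathbb{D}$ the open unit disc. For a function $f$ on a subset $X$ of the Riemann sphere, $f^*$ is defined on $\{\bar z^{-1}:z\in X\}$ by $f^*(z)=\overline{f(\bar z^{-1})}$; on $\mathbb{T}$, $f^*=\overline{f}$. For $f\in L^2(\mathbb{T})$, $\hat f\in\ell^2(\mathbb{Z})$ is its sequence of Fourier coefficients. Nonlinear Fourier transform. For a finitely supported complex sequence $F=(F_k)_{k\in\mathbb{Z}}$ put, for $z\in\mathbb{T}$, $$\begin{pmatrix} a(z) & b(z)\\ -b^*(z) & a^*(z)\end{pmatrix}=\prod_{k=-\infty}^{\infty}\frac{1}{\sqrt{1+|F_k|^2}}\begin{pmatrix}1 & F_kz^k\\ -\overline{F_k}z^{-k} & 1\end{pmatrix},$$ where the factors with lower indices appear to the left. The pair $(a,b)$ is the $SU(2)$-valued nonlinear Fourier transform (NLFT) of $F$; it satisfies $|a|^2+|b|^2=1$ on $\mathbb{T}$. For $F\in\ell^2(\mathbb{Z})$, $(a,b)$ is defined as the limit (entrywise in $L^2(\mathbb{T})$) of the NLFTs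 of the truncations of $F$ to $[-N,N]$ as $N\to\infty$. The function $a^*$ extends to a bounded holomorphic function on $\mathbb{D}$, and $a^*(0)=\prod_k(1+|F_k|^2)^{-1/2}$. Weights. $w:\mathbb{Z}\to[1,\infty)$ is a strong Beurling weight if $w(-n)=w(n)$ for all $n$; $w(n+m)\le w(n)w(m)$ for all $n,m$; and $\lim_{n\to\infty}\frac{\log w(n)}{n}=0$. Define $\ell^1_w=\{c=(c_n)_{n\in\mathbb{Z}}:\|c\|_{\ell^1_w}:=\sum_{n}|c_n|w(n)<\infty\}$ and $A_w=\{f:\mathbb{T}\to\mathbb{C}:\hat f\in\ell^1_w\}$ with $\|f\|_{A_w}=\|\hat f\|_{\ell^1_w}$ and pointwise multiplication. *)

(* Defs.v *)
From HB Require Import structures.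
From mathcomp Require Import all_boot all_order all_algebra.
From mathcomp Require Import complex.
From mathcomp Require Import all_classical all_reals all_analysis.

Set Implicit Arguments.
Unset Strict Implicit.
Unset Printing Implicit Defensive.

Import Order.TTheory GRing.Theory Num.Theory.
Import numFieldNormedType.Exports.
Import Normc.

Local Open Scope classical_set_scope.
Local Open Scope ring_scope.

(* Functions on the unit circle are represented by functions R[i] -> R[i] of
   which only the values at the points expi t matter; they are integrated
   against normalised arc length. *)

Definition expi {R : realType} (t : R) : R[i] := Complex (cos t) (sin t).

Definition cexp {R : realType} (z : R[i]) : R[i] :=
  real_complex R (expR (complex.Re z)) * expi (complex.Im z).

Definition circ_dom (R : realType) : set R := `[0, 2 * pi]%classic.
Arguments circ_dom : clear implicits.

Definition circ_measurable {R : realType} (f : R[i] -> R[i]) : Prop :=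
  measurable_fun (circ_dom R) (fun t : R => complex.Re (f (expi t))) /\
  measurable_fun (circ_dom R) (fun t : R => complex.Im (f (expi t))).

Definition circ_int {R : realType} (f : R[i] -> R[i]) : R[i] :=
  let I (g : R -> R) :=
    (2 * pi)^-1 * Rintegral (@lebesgue_measure R) (circ_dom R) g in
  Complex (I (fun t => complex.Re (f (expi t))))
          (I (fun t => complex.Im (f (expi t)))).

Definition L2sq {R : realType} (f : R[i] -> R[i]) : \bar R :=
  ((2 * pi)^-1%:E *
   \int[@lebesgue_measure R]_(t in circ_dom R) ((normc (f (expi t))) ^+ 2)%:E)%E.

Definition in_L2 {R : realType} (f : R[i] -> R[i]) : Prop :=
  circ_measurable f /\ (L2sq f < +oo)%E.

Definition L2_cvg {R : realType} (u : nat -> R[i] -> R[i]) (f : R[i] -> R[i]) :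
    Prop :=
  (fun N : nat => L2sq (fun z => u N z - f z)) @ \oo --> (0 : \bar R).

Definition fourier {R : realType} (f : R[i] -> R[i]) (n : int) : R[i] :=
  circ_int (fun z => f z * z ^ (- n)).

Definition cstar {R : realType} (f : R[i] -> R[i]) (z : R[i]) : R[i] :=
  conjc (f (conjc z)^-1).

Definition mx2 {R : realType} (p q r s : R[i]) : 'M[R[i]]_2 :=
  \matrix_(i < 2, j < 2)
    if i == 0 then (if j == 0 then p else q) else (if j == 0 then r else s).

Definition nlft_factor {R : realType} (F : int -> R[i]) (k : int) (z : R[i]) :
    'M[R[i]]_2 :=
  real_complex R (Num.sqrt (1 + normc (F k) ^+ 2))^-1 *:
    mx2 1 (F k * z ^ k) (- (conjc (F k) * z ^ (- k))) 1.

(* The ordered product over -N <= k <= N, lower indices to the left, that is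
   the NLFT matrix of the truncation of F to [-N, N]: the remaining factors
   are identity matrices. *)
Definition nlft_trunc {R : realType} (F : int -> R[i]) (N : nat) (z : R[i]) :
    'M[R[i]]_2 :=
  \prod_(j < (2 * N).+1) nlft_factor F (j%:Z - N%:Z) z.

Definition in_l2 {R : realType} (F : int -> R[i]) : Prop :=
  (\esum_(k in [set: int]) (normc (F k) ^+ 2)%:E < +oo)%E.

Definition is_nlft {R : realType} (F : int -> R[i]) (a b : R[i] -> R[i]) :
    Prop :=
  [/\ in_L2 a, in_L2 b,
      L2_cvg (fun N z => nlft_trunc F N z 0 0) a &
      L2_cvg (fun N z => nlft_trunc F N z 0 1) b].

(* f is given by its values on the circle. If f has no negative frequencies,
   its holomorphic extension to the disc is the sum of the power series
   \sum_(n >= 0) fourier f n * z ^+ n; being outer means that this extension is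
     c * exp (1/2pi \int (e^it + z) / (e^it - z) log |f (e^it)| dt), |c| = 1.
   The integrability of log |f| is stated with the extended-real logarithm lne,
   for which lne 0 = -oo, because ln 0 = 0. *)
Definition herglotz_log {R : realType} (f : R[i] -> R[i]) (z : R[i]) : R[i] :=
  circ_int (fun x => (x + z) / (x - z) * real_complex R (ln (normc (f x)))).

Definition outer {R : realType} (f : R[i] -> R[i]) : Prop :=
  [/\ in_L2 f,
      forall n : int, n < 0 -> fourier f n = 0,
      (@lebesgue_measure R).-integrable (circ_dom R)
        (fun t => lne (normc (f (expi t)))%:E) &
      exists2 c : R[i], normc c = 1 &
        forall z : R[i], normc z < 1 ->
          (fun N : nat =>
             normc (\sum_(n < N) fourier f n%:Z * z ^+ n
                    - c * cexp (herglotz_log f z))) @ \oo --> (0 : R)].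

Definition strong_beurling_weight {R : realType} (w : int -> R) : Prop :=
  [/\ forall n, 1 <= w n,
      forall n, w (- n) = w n,
      forall n m, w (n + m) <= w n * w m &
      (fun n : nat => ln (w n%:Z) / n%:R) @ \oo --> (0 : R)].

Definition l1w_norm {R : realType} (w : int -> R) (c : int -> R[i]) : \bar R :=
  (\esum_(n in [set: int]) (normc (c n) * w n)%:E)%E.

(* The norm is +oo for functions that are not square integrable on the circle,
   whose Fourier coefficients would be meaningless. *)
Definition Aw_norm {R : realType} (w : int -> R) (f : R[i] -> R[i]) : \bar R :=
  if `[< in_L2 f >] then l1w_norm w (fourier f) else +oo%E.

(* Main.v *)
Require Import Defs.
From mathcomp Require Import all_boot all_order all_algebra.
From mathcomp Require Import complex ring lra zify.
From mathcomp Require Import all_classical all_reals all_analysis.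
From mathcomp Require Import measurable_realfun.

(** The statement rests on the layer-stripping solution of the inverse problem.
    Put [c = b / a], [h n = |c^ n|] for the moduli of its Fourier coefficients,
    [beta] and [Q] for the weighted norms of [b] and [c].  The claim follows, with
    [C = 1], from two inequalities:
      [Q <= beta / sqrt (1 - beta ^ 2)]  and  [|F|_w <= Q / (1 - Q ^ 2)];
    indeed [beta < 1 / sqrt 2 - eps] gives [1 - Q ^ 2 >= 1 - 2 beta ^ 2 >= eps].

    First inequality.  As [|a|^2 = 1 - |b|^2] and [a^*] is outer, [1 / a^*] is, up
    to a unimodular constant, the exponential of the analytic half of
    [- log (1 - |b|^2)].  This function has norm at most [- log (1 - beta ^ 2)] by
    the power series of the logarithm, and passing to the analytic half divides
    the norm of a real function by two because the weight is even
    ([analytic_half]).  All this is done with trigonometric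
    polynomials [g] ([szego_approx]) obtained from a polynomial [p] close to [b].
    To see that [a^* g] tends in [L^2] to a unimodular constant, expand the square:
    [|a g|^2] is controlled pointwise, and the mean of [a^* g] is the product of
    the means of [a^*] and [g], the first of which is known from outerness
    ([outer_inverse_approx]).  Thus only the value of [a^*] at the origin matters.
    Norms of coefficients are lower semicontinuous, so [p conj g], which tends to
    a constant multiple of [c], yields the bound ([quotient_coefficients]).

    Second inequality.  Cut the product that defines the transform of a truncation
    at the index [n], and let [(A, B)] be the first row of the right factor: [A]
    has frequencies at most [0], [B] has frequencies at least [n], and [F n] is the
    quotient of the coefficient of [B] at [n] by that of [A] at [0]
    ([fourier_su2_row]).  The entries of the left factor are [a A^* + b B^*] and
    [b A - a B]; divided by [a], whose inverse has only nonpositive frequencies,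
    they have no frequency above [0] and above [n - 1].  Hence the coefficients of
    [c A - B] from [n] on and those of [A^* + c B^*] from [1] on vanish, up to an
    error that tends to zero with the truncation ([truncated_relations]).  Taking
    moduli gives [|B^| <= A^(0) h + S |A^|] and [|A^| <= S |B^|], where [S] is the
    Hankel operator of [h] and the coefficients of [A] are indexed by the opposite
    frequencies.  Since [|c^|] has norm [Q < 1] this can be iterated, and
    [|F n|] is at most the sum of [S ^ (2 l) h] at [n] ([hankel_iterate]).  On the
    weighted space [S] has norm at most [Q], as [w] is even and submultiplicative,
    so the sum has norm at most [Q + Q ^ 3 + ... = Q / (1 - Q ^ 2)]
    ([wsum_majorant]).

    The functions [a] and [b] are only given almost everywhere as [L^2] limits, so
    they are first corrected on a null set, which makes them bounded. *)

Set Implicit Arguments.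
Unset Strict Implicit.
Unset Printing Implicit Defensive.

Import Order.TTheory GRing.Theory Num.Theory.
Import numFieldNormedType.Exports.
Import Normc.
Local Open Scope classical_set_scope.
Local Open Scope ring_scope.

(** * Complex numbers of modulus one *)

Section UnitCircle.
Variable R : realType.
Implicit Types (z u v : R[i]) (n m : int) (t : R).

Lemma normc_ge0 z : 0 <= normc z.
Proof. by case: z => x y; exact: sqrtr_ge0. Qed.

Lemma normc_sqr z : normc z ^+ 2 = complex.Re z ^+ 2 + complex.Im z ^+ 2.
Proof. by case: z => x y /=; rewrite sqr_sqrtr// addr_ge0 ?sqr_ge0. Qed.

Lemma normc_conj z : normc (conjc z) = normc z.
Proof. by case: z => x y /=; rewrite sqrrN. Qed.

Lemma mul_conjc z : z * conjc z = real_complex R (normc z ^+ 2).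
Proof.
rewrite normc_sqr; case: z => x y; apply/eqP; rewrite eq_complex /=.
by apply/andP; split; apply/eqP; ring.
Qed.

Lemma conjcM z u : conjc (z * u) = conjc z * conjc u.
Proof. exact: rmorphM. Qed.

Lemma conjcD z u : conjc (z + u) = conjc z + conjc u.
Proof. exact: rmorphD. Qed.

Lemma conjcN z : conjc (- z) = - conjc z.
Proof. exact: rmorphN. Qed.

Lemma normc_real t : normc (real_complex R t) = `|t|.
Proof. by rewrite /= expr0n addr0 sqrtr_sqr. Qed.

Lemma normcX z k : normc (z ^+ k) = normc z ^+ k.
Proof.
elim: k => [|k IH]; first by rewrite !expr0; exact: (@normc1 R).
by rewrite !exprS normcM IH.
Qed.

Lemma normcB z u : normc (z - u) = normc (u - z).
Proof. by rewrite -normcN opprB. Qed.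

Lemma normc_sum I (s : seq I) (f : I -> R[i]) :
  normc (\sum_(i <- s) f i) <= \sum_(i <- s) normc (f i).
Proof.
elim: s => [|i s IH]; first by rewrite !big_nil (@normc0 R).
by rewrite !big_cons (le_trans (le_normcD _ _))// lerD2l.
Qed.

Lemma abs_Re_le z : `|complex.Re z| <= normc z.
Proof.
by case: z => x y /=; rewrite -sqrtr_sqr ler_wsqrtr// lerDl sqr_ge0.
Qed.

Lemma abs_Im_le z : `|complex.Im z| <= normc z.
Proof.
by case: z => x y /=; rewrite -sqrtr_sqr ler_wsqrtr// lerDr sqr_ge0.
Qed.

Lemma normc_sub_ge z u : `|normc z - normc u| <= normc (z - u).
Proof.
rewrite ler_norml; apply/andP; split.
  rewrite lerBrDl lerBlDr normcB -{1}(subrK z u) addrC.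
  by rewrite (le_trans (le_normcD _ _))// addrC.
by rewrite lerBlDr -{1}(subrK u z) le_normcD.
Qed.

Lemma unit_neq0 z : normc z = 1 -> z != 0.
Proof.
move=> z1; apply/eqP => z0; move: z1; rewrite z0 (@normc0 R) => /eqP.
by rewrite eq_sym oner_eq0.
Qed.

Lemma unit_conj z : normc z = 1 -> conjc z = z^-1.
Proof.
move=> z1; apply: (mulfI (unit_neq0 z1)).
by rewrite mul_conjc z1 expr1n divff// unit_neq0.
Qed.

Lemma normc_exprz z n : normc z = 1 -> normc (z ^ n) = 1.
Proof.
by move=> z1; case: n => n; rewrite /exprz ?normcV normcX z1 expr1n ?invr1.
Qed.

Lemma unit_conj_exprz z n : normc z = 1 -> conjc (z ^ n) = z ^ (- n).
Proof. by move=> z1; rewrite unit_conj ?normc_exprz// invr_expz. Qed.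

Lemma unit_exprzD z n m : normc z = 1 -> z ^ (n + m) = z ^ n * z ^ m.
Proof. by move=> z1; rewrite expfzDr// unit_neq0. Qed.

Lemma normc_expi t : normc (expi t) = 1.
Proof. by rewrite /= cos2Dsin2 sqrtr1. Qed.

End UnitCircle.

(** * Trigonometric polynomials and weighted coefficient norms *)

Section TrigonometricPolynomials.
Variable R : realType.
Implicit Types (z u v : R[i]) (s : seq (R[i] * int)) (P : pred int).
Implicit Types (f g : R[i] -> R[i]) (w : int -> R) (Q : R).

(** A trigonometric polynomial is presented by a list of monomials in which
    frequencies may repeat: the norm of a presentation is then trivially
    submultiplicative, and it bounds the weighted norm of the coefficients. *)
Definition trig s z : R[i] := \sum_(m <- s) m.1 * z ^ m.2.

Definition trig_norm w s : R := \sum_(m <- s) normc m.1 * w m.2.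

(** [P] restricts the frequencies and [Q] bounds the norm of a presentation.
    Values matter only on the circle, where conjugation is inversion. *)
Definition wpoly w Q P f : Prop :=
  exists s, [/\ all (fun m => P m.2) s, trig_norm w s <= Q &
    forall z, normc z = 1 -> f z = trig s z].

Definition tpoly P f : Prop := exists Q, wpoly (fun=> 1) Q P f.

(** Symmetry serves for conjugates, submultiplicativity for products, and the
    lower bound for estimates in the uniform norm. *)
Definition even_weight w :=
  [/\ forall n, 1 <= w n, forall n, w (- n) = w n &
      forall n m, w (n + m) <= w n * w m].

Lemma even_weight1 : even_weight (fun=> 1).
Proof. by split=> // n m; rewrite mulr1. Qed.

Lemma wpoly_weak w Q Q' P P' f f' : wpoly w Q P f -> Q <= Q' ->
  (forall k, P k -> P' k) -> (forall z, normc z = 1 -> f z = f' z) ->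
  wpoly w Q' P' f'.
Proof.
move=> [s [Ps Qs fs]] QQ PP ff; exists s; split.
- by apply: sub_all Ps => m; exact: PP.
- exact: le_trans QQ.
- by move=> z z1; rewrite -ff// fs.
Qed.

Lemma tpoly_weak P P' f f' : tpoly P f ->
  (forall k, P k -> P' k) -> (forall z, normc z = 1 -> f z = f' z) ->
  tpoly P' f'.
Proof. by move=> [Q fQ] PP ff; exists Q; apply: wpoly_weak fQ _ PP ff. Qed.

Lemma wpoly_monomial w P u k : P k ->
  wpoly w (normc u * w k) P (fun z => u * z ^ k).
Proof.
move=> Pk; exists [:: (u, k)]; split=> [||z _].
- by rewrite /= Pk.
- by rewrite /trig_norm big_seq1.
- by rewrite /trig big_seq1.
Qed.

Lemma wpolyD w Q1 Q2 P f g : wpoly w Q1 P f -> wpoly w Q2 P g ->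
  wpoly w (Q1 + Q2) P (fun z => f z + g z).
Proof.
move=> [s [Ps Qs fs]] [r [Pr Qr gr]]; exists (s ++ r); split=> [||z z1].
- by rewrite all_cat Ps.
- by rewrite /trig_norm big_cat lerD.
- by rewrite /trig big_cat -/(trig s z) -/(trig r z) fs// gr.
Qed.

Lemma wpolyM w Q1 Q2 P1 P2 P f g : even_weight w ->
  (forall i j, P1 i -> P2 j -> P (i + j)) ->
  wpoly w Q1 P1 f -> wpoly w Q2 P2 g -> wpoly w (Q1 * Q2) P (fun z => f z * g z).
Proof.
move=> [w1 wN wD] PP [s [Ps Qs fs]] [r [Pr Qr gr]].
have w0 k : 0 <= w k by exact: le_trans (w1 k).
exists [seq (m.1 * l.1, m.2 + l.2) | m <- s, l <- r]; split=> [||z z1].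
- apply/allP => x /allpairsP[[m l] [/= ms lr ->]] /=.
  by apply: PP; [exact: (allP Ps)|exact: (allP Pr)].
- apply: (@le_trans _ _ (trig_norm w s * trig_norm w r)); last first.
    apply: ler_pM => //; apply: sumr_ge0 => m _; exact: mulr_ge0 (normc_ge0 _) _.
  rewrite /trig_norm big_allpairs_dep mulr_suml ler_sum// => m _.
  rewrite mulr_sumr ler_sum// => l _ /=.
  rewrite normcM [leRHS]mulrACA ler_wpM2l// ?mulr_ge0// ?normc_ge0//.
- rewrite fs// gr// /trig big_allpairs_dep mulr_suml; apply: eq_bigr => m _.
  rewrite mulr_sumr; apply: eq_bigr => l _ /=.
  by rewrite unit_exprzD// mulrACA.
Qed.

Lemma wpolyZ w Q P f u : wpoly w Q P f ->
  wpoly w (normc u * Q) P (fun z => u * f z).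
Proof.
move=> [s [Ps Qs fs]]; exists [seq (u * m.1, m.2) | m <- s]; split=> [||z z1].
- by rewrite all_map.
- rewrite /trig_norm big_map; under eq_bigr do rewrite /= normcM -mulrA.
  by rewrite -mulr_sumr ler_wpM2l// normc_ge0.
- rewrite fs// /trig big_map mulr_sumr.
  by apply: eq_bigr => m _; rewrite /= mulrA.
Qed.

Lemma wpoly_conj w Q P P' f : even_weight w -> (forall k, P k -> P' (- k)) ->
  wpoly w Q P f -> wpoly w Q P' (fun z => conjc (f z)).
Proof.
move=> [_ wN _] PP [s [Ps Qs fs]].
exists [seq (conjc m.1, - m.2) | m <- s]; split=> [||z z1].
- by rewrite all_map; apply: sub_all Ps => m /=; exact: PP.
- by rewrite /trig_norm big_map; under eq_bigr do rewrite normc_conj wN.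
- rewrite fs// /trig big_map rmorph_sum; apply: eq_bigr => m _.
  by rewrite rmorphM/= unit_conj_exprz.
Qed.

Lemma tpolyD P f g : tpoly P f -> tpoly P g -> tpoly P (fun z => f z + g z).
Proof. by move=> [Q fQ] [Q' gQ]; exists (Q + Q'); exact: wpolyD. Qed.

Lemma tpolyM P1 P2 P f g : (forall i j, P1 i -> P2 j -> P (i + j)) ->
  tpoly P1 f -> tpoly P2 g -> tpoly P (fun z => f z * g z).
Proof.
move=> PP [Q fQ] [Q' gQ]; exists (Q * Q').
exact: wpolyM even_weight1 PP fQ gQ.
Qed.

Lemma tpolyZ P f u : tpoly P f -> tpoly P (fun z => u * f z).
Proof. by move=> [Q fQ]; eexists; exact: wpolyZ fQ. Qed.

Lemma tpolyB P f g : tpoly P f -> tpoly P g -> tpoly P (fun z => f z - g z).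
Proof.
move=> fP gP; apply: tpoly_weak (tpolyD fP (tpolyZ (-1) gP)) _ _ => // z _.
by rewrite mulN1r.
Qed.

Lemma tpoly_conj P P' f : (forall k, P k -> P' (- k)) -> tpoly P f ->
  tpoly P' (fun z => conjc (f z)).
Proof. by move=> PP [Q fQ]; exists Q; apply: wpoly_conj PP fQ; exact: even_weight1. Qed.

Lemma tpoly_monomial P u k : P k -> tpoly P (fun z => u * z ^ k).
Proof. by move=> Pk; eexists; exact: wpoly_monomial. Qed.

Lemma tpoly_cst (P : pred int) u : P 0 -> tpoly P (fun=> u).
Proof.
move=> P0; apply: tpoly_weak (@tpoly_monomial P u 0 P0) _ _ => // z _.
by rewrite expr0z mulr1.
Qed.

Lemma wpoly_tpoly w Q P f : even_weight w -> wpoly w Q P f -> tpoly P f.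
Proof.
move=> [w1 _ _] [s [Ps Qs fs]]; exists Q, s; split=> //.
apply: le_trans Qs; apply: ler_sum => m _.
by apply: ler_wpM2l; [exact: normc_ge0|exact: w1].
Qed.

Lemma wpoly_bound w Q P f z : even_weight w -> wpoly w Q P f ->
  normc z = 1 -> normc (f z) <= Q.
Proof.
move=> [w1 _ _] [s [Ps Qs fs]] z1; rewrite fs//.
apply: le_trans (normc_sum _ _) _; apply: le_trans Qs; apply: ler_sum => m _.
rewrite normcM normc_exprz//; apply: ler_wpM2l; [exact: normc_ge0|exact: w1].
Qed.

End TrigonometricPolynomials.

(** * Means over the circle *)

Section Means.
Variable R : realType.
Implicit Types (z u v : R[i]) (g h : R[i] -> R) (f : R[i] -> R[i]).
Local Notation mu := (@lebesgue_measure R).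
Local Notation dom := (circ_dom R).

Definition rmean g : R := (2 * pi)^-1 * Rintegral mu dom (fun t => g (expi t)).

Lemma circ_intE f : circ_int f =
  Complex (rmean (fun z => complex.Re (f z))) (rmean (fun z => complex.Im (f z))).
Proof. by []. Qed.

(** Bounded measurable real functions.  All functions that matter can be
    arranged to be bounded, and unlike square-integrable functions, bounded ones
    are closed under products. *)
Definition bmr g : Prop := measurable_fun dom (fun t => g (expi t)) /\
  exists M, forall z, normc z = 1 -> `|g z| <= M.

Definition bmc f : Prop :=
  bmr (fun z => complex.Re (f z)) /\ bmr (fun z => complex.Im (f z)).

Lemma measurable_circ_dom : measurable dom.
Proof. exact: measurable_itv. Qed.

Lemma pi2_gt0 : 0 < 2 * pi :> R.
Proof. by rewrite mulr_gt0 ?pi_gt0. Qed.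

Lemma circ_dom_measure : mu dom = (2 * pi)%:E.
Proof.
by rewrite /circ_dom lebesgue_measure_itv/= lte_fin pi2_gt0 oppr0 adde0.
Qed.

Lemma bmr_int g : bmr g -> mu.-integrable dom (EFin \o (fun t => g (expi t))).
Proof.
move=> [mg [M gM]]; apply: measurable_bounded_integrable => //.
- exact: measurable_circ_dom.
- by have := circ_dom_measure => /= ->; rewrite ltry.
- exists M; split; first exact: num_real.
  move=> x Mx t _ /=; apply: le_trans (ltW Mx); apply: gM; exact: normc_expi.
Qed.

Lemma bmr_ext g h : bmr g -> (forall z, normc z = 1 -> g z = h z) -> bmr h.
Proof.
move=> [mg [M gM]] gh; split; last by exists M => z z1; rewrite -gh ?gM.
by apply: eq_measurable_fun mg => t _; rewrite gh// normc_expi.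
Qed.

Lemma bmr_cst (c : R) : bmr (fun=> c).
Proof. by split; [exact: measurable_cst|exists `|c|]. Qed.

Lemma bmrD g h : bmr g -> bmr h -> bmr (fun z => g z + h z).
Proof.
move=> [mg [M gM]] [mh [N hN]]; split; first exact: measurable_funD.
by exists (M + N) => z z1; rewrite (le_trans (ler_normD _ _))// lerD ?gM ?hN.
Qed.

Lemma bmrM g h : bmr g -> bmr h -> bmr (fun z => g z * h z).
Proof.
move=> [mg [M gM]] [mh [N hN]]; split; first exact: measurable_funM.
by exists (M * N) => z z1; rewrite normrM ler_pM ?gM ?hN.
Qed.

Lemma bmrZ (c : R) g : bmr g -> bmr (fun z => c * g z).
Proof. by move=> gb; apply: bmrM => //; exact: bmr_cst. Qed.

Lemma bmrB g h : bmr g -> bmr h -> bmr (fun z => g z - h z).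
Proof.
move=> gb hb; apply: bmr_ext (bmrD gb (bmrZ (-1) hb)) _ => z _.
by rewrite mulN1r.
Qed.

Lemma bmr_comp (phi : R -> R) g (M : R) : measurable_fun setT phi -> bmr g ->
  (forall z, normc z = 1 -> `|phi (g z)| <= M) -> bmr (fun z => phi (g z)).
Proof.
move=> mphi [mg _] gM; split; last by exists M.
exact: (measurableT_comp mphi mg).
Qed.

Lemma bmr_norm g : bmr g -> bmr (fun z => `|g z|).
Proof.
move=> gb; have [_ [M gM]] := gb.
apply: (bmr_comp (M := M)) gb _; first exact: normr_measurable.
by move=> z z1; rewrite normr_id gM.
Qed.

Lemma rmean_ext g h : (forall z, normc z = 1 -> g z = h z) -> rmean g = rmean h.
Proof.
move=> gh; rewrite /rmean; congr (_ * _); apply: eq_Rintegral => t _.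
by apply: gh; exact: normc_expi.
Qed.

Lemma rmeanD g h : bmr g -> bmr h ->
  rmean (fun z => g z + h z) = rmean g + rmean h.
Proof.
move=> gb hb; rewrite /rmean -mulrDr; congr (_ * _).
by rewrite -RintegralD//; [exact: measurable_circ_dom|exact: bmr_int|exact: bmr_int].
Qed.

Lemma rmeanZ (c : R) g : bmr g -> rmean (fun z => c * g z) = c * rmean g.
Proof.
move=> gb; rewrite /rmean mulrCA; congr (_ * _).
by rewrite RintegralZl//; [exact: measurable_circ_dom|exact: bmr_int].
Qed.

Lemma rmeanB g h : bmr g -> bmr h ->
  rmean (fun z => g z - h z) = rmean g - rmean h.
Proof.
move=> gb hb.
rewrite (@rmean_ext _ (fun z => g z + (-1) * h z)); last by move=> z _; rewrite mulN1r.
by rewrite rmeanD ?rmeanZ ?mulN1r//; exact: bmrZ.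
Qed.

Lemma rmean_cst (c : R) : rmean (fun=> c) = c.
Proof.
rewrite /rmean Rintegral_cst; last exact: measurable_circ_dom.
rewrite [X in fine X](_ : _ = (2 * pi)%:E); last exact: circ_dom_measure.
rewrite /= mulrCA mulVf ?mulr1// gt_eqF//; exact: pi2_gt0.
Qed.

Lemma le_rmean g h : bmr g -> bmr h -> (forall z, normc z = 1 -> g z <= h z) ->
  rmean g <= rmean h.
Proof.
move=> gb hb gh; rewrite /rmean ler_wpM2l//.
  by rewrite invr_ge0 ltW// pi2_gt0.
apply: le_Rintegral; [exact: measurable_circ_dom|exact: bmr_int|exact: bmr_int|].
by move=> t _; apply: gh; exact: normc_expi.
Qed.

Lemma rmean_ge0 g : bmr g -> (forall z, normc z = 1 -> 0 <= g z) -> 0 <= rmean g.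
Proof.
by move=> gb g0; rewrite -(rmean_cst 0); apply: le_rmean => //; exact: bmr_cst.
Qed.

(** Jensen, from the nonnegativity of the variance. *)
Lemma rmean_sqr_le g : bmr g -> rmean g ^+ 2 <= rmean (fun z => g z ^+ 2).
Proof.
move=> gb; have g2 : bmr (fun z => g z * g z) by exact: bmrM.
have gm : bmr (fun z => 2 * rmean g * g z) by exact: bmrZ.
have vb : bmr (fun z => g z * g z - 2 * rmean g * g z + rmean g ^+ 2).
  by apply: bmrD (bmr_cst _); exact: bmrB.
have := rmean_ge0 vb.
rewrite rmeanD ?rmean_cst; [|exact: bmrB|exact: bmr_cst].
rewrite rmeanB// rmeanZ//.
rewrite (@rmean_ext (fun z => g z ^+ 2) (fun z => g z * g z)); last first.
  by move=> z _; rewrite expr2.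
have var z : 0 <= g z * g z - 2 * rmean g * g z + rmean g ^+ 2.
  have -> : g z * g z - 2 * rmean g * g z + rmean g ^+ 2 =
    (g z - rmean g) ^+ 2 by ring.
  exact: sqr_ge0.
move=> /(_ (fun z _ => var z)) H; rewrite -subr_ge0; apply: le_trans H _.
by rewrite le_eqVlt; apply/orP; left; apply/eqP; ring.
Qed.

(** ** Complex-valued functions *)

Lemma bmc_ext f f' : bmc f -> (forall z, normc z = 1 -> f z = f' z) -> bmc f'.
Proof.
by move=> [fr fi] ff; split; [apply: bmr_ext fr _|apply: bmr_ext fi _] => z z1;
  rewrite ff.
Qed.

Lemma bmcD f f' : bmc f -> bmc f' -> bmc (fun z => f z + f' z).
Proof.
move=> [fr fi] [fr' fi']; split.
  by apply: bmr_ext (bmrD fr fr') _ => z _; case: (f z); case: (f' z).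
by apply: bmr_ext (bmrD fi fi') _ => z _; case: (f z); case: (f' z).
Qed.

Lemma bmcM f f' : bmc f -> bmc f' -> bmc (fun z => f z * f' z).
Proof.
move=> [fr fi] [fr' fi']; split.
  by apply: bmr_ext (bmrB (bmrM fr fr') (bmrM fi fi')) _ => z _;
    case: (f z); case: (f' z).
by apply: bmr_ext (bmrD (bmrM fr fi') (bmrM fi fr')) _ => z _;
    case: (f z); case: (f' z).
Qed.

Lemma bmc_cst u : bmc (fun=> u).
Proof. by split; exact: bmr_cst. Qed.

Lemma bmcZ u f : bmc f -> bmc (fun z => u * f z).
Proof. by move=> fb; apply: bmcM => //; exact: bmc_cst. Qed.

Lemma bmcB f f' : bmc f -> bmc f' -> bmc (fun z => f z - f' z).
Proof.
move=> fb fb'; apply: bmc_ext (bmcD fb (bmcZ (-1) fb')) _ => z _.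
by rewrite mulN1r.
Qed.

Lemma bmc_conj f : bmc f -> bmc (fun z => conjc (f z)).
Proof.
move=> [fr fi]; split; first by apply: bmr_ext fr _ => z _; case: (f z).
by apply: bmr_ext (bmrZ (-1) fi) _ => z _; case: (f z) => x y; rewrite mulN1r.
Qed.

Lemma bmc_sum I (r : seq I) (F : I -> R[i] -> R[i]) : (forall i, bmc (F i)) ->
  bmc (fun z => \sum_(i <- r) F i z).
Proof.
move=> Fb; elim: r => [|i r IH].
  by apply: bmc_ext (bmc_cst 0) _ => z _; rewrite big_nil.
by apply: bmc_ext (bmcD (Fb i) IH) _ => z _; rewrite big_cons.
Qed.

Lemma bmr_Re f : bmc f -> bmr (fun z => complex.Re (f z)).
Proof. by case. Qed.

Lemma bmr_normc2 f : bmc f -> bmr (fun z => normc (f z) ^+ 2).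
Proof.
move=> [fr fi]; apply: bmr_ext (bmrD (bmrM fr fr) (bmrM fi fi)) _ => z _.
by rewrite normc_sqr !expr2.
Qed.

Lemma bmr_normc f : bmc f -> bmr (fun z => normc (f z)).
Proof.
move=> fb; have f2 := bmr_normc2 fb; have [_ [M fM]] := f2.
apply: (@bmr_ext (fun z => Num.sqrt (normc (f z) ^+ 2))); last first.
  by move=> z _; rewrite sqrtr_sqr ger0_norm// normc_ge0.
apply: (bmr_comp (M := Num.sqrt M)) f2 _.
  apply: continuous_measurable_fun; exact: sqrt_continuous.
move=> z z1; rewrite ger0_norm ?sqrtr_ge0// ler_wsqrtr//.
by apply: le_trans (fM z z1); exact: ler_norm.
Qed.

Lemma circ_int_ext f f' : (forall z, normc z = 1 -> f z = f' z) ->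
  circ_int f = circ_int f'.
Proof.
by move=> ff; rewrite !circ_intE; congr Complex; apply: rmean_ext => z z1;
  rewrite ff.
Qed.

Lemma circ_intD f f' : bmc f -> bmc f' ->
  circ_int (fun z => f z + f' z) = circ_int f + circ_int f'.
Proof.
move=> [fr fi] [fr' fi']; rewrite !circ_intE.
transitivity (Complex
  (rmean (fun z => complex.Re (f z) + complex.Re (f' z)))
  (rmean (fun z => complex.Im (f z) + complex.Im (f' z)))).
  by congr Complex; apply: rmean_ext => z _; case: (f z); case: (f' z).
by rewrite !rmeanD.
Qed.

Lemma circ_intZ u f : bmc f -> circ_int (fun z => u * f z) = u * circ_int f.
Proof.
move=> [fr fi]; rewrite !circ_intE; case: u => x y.
transitivity (Complex
  (rmean (fun z => x * complex.Re (f z) - y * complex.Im (f z)))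
  (rmean (fun z => x * complex.Im (f z) + y * complex.Re (f z)))).
  by congr Complex; apply: rmean_ext => z _; case: (f z) => a b /=; ring.
rewrite rmeanB ?rmeanD ?rmeanZ//; try exact: bmrZ.
Qed.

Lemma circ_intB f f' : bmc f -> bmc f' ->
  circ_int (fun z => f z - f' z) = circ_int f - circ_int f'.
Proof.
move=> fb fb'.
rewrite (@circ_int_ext _ (fun z => f z + (-1) * f' z)); last first.
  by move=> z _; rewrite mulN1r.
by rewrite circ_intD ?circ_intZ ?mulN1r//; exact: bmcZ.
Qed.

Lemma circ_int_cst u : circ_int (fun=> u) = u.
Proof. by rewrite circ_intE !rmean_cst; case: u. Qed.

Lemma circ_int_sum I (r : seq I) (F : I -> R[i] -> R[i]) :
  (forall i, bmc (F i)) ->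
  circ_int (fun z => \sum_(i <- r) F i z) = \sum_(i <- r) circ_int (F i).
Proof.
move=> Fb; elim: r => [|i r IH].
  rewrite big_nil -[RHS](circ_int_cst 0).
  by apply: circ_int_ext => z _; rewrite big_nil.
rewrite big_cons -IH -circ_intD//; last exact: bmc_sum.
by apply: circ_int_ext => z _; rewrite big_cons.
Qed.

Lemma circ_int_conj f : bmc f ->
  circ_int (fun z => conjc (f z)) = conjc (circ_int f).
Proof.
move=> [fr fi]; rewrite !circ_intE /=; congr Complex.
  by apply: rmean_ext => z _; case: (f z).
rewrite -mulN1r -rmeanZ//; apply: rmean_ext => z _.
by case: (f z) => x y; rewrite mulN1r.
Qed.

(** Rotating the mean onto the positive axis reduces to real parts. *)
Lemma normc_circ_int_le f : bmc f ->
  normc (circ_int f) <= rmean (fun z => normc (f z)).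
Proof.
move=> fb; have [->|I0] := eqVneq (circ_int f) 0.
  rewrite (@normc0 R); apply: rmean_ge0; first exact: bmr_normc.
  by move=> z _; exact: normc_ge0.
set I := circ_int f in I0 *.
have nI : normc I != 0 by apply: contra I0 => /eqP/eq0_normc ->.
pose u := conjc I / real_complex R (normc I).
have u1 : normc u = 1.
  by rewrite /u normcM normcV normc_real normc_conj ger0_norm ?normc_ge0// divff.
have -> : normc I = rmean (fun z => complex.Re (u * f z)).
  have := circ_intZ u fb; rewrite -/I.
  have -> : u * I = real_complex R (normc I).
    rewrite /u mulrAC (mulrC _ I) mul_conjc expr2 rmorphM/= mulfK//.
    by rewrite (inj_eq (@complexI R)).
  by rewrite circ_intE => /(congr1 (@complex.Re R)).
apply: le_rmean; [exact: bmr_Re (bmcZ u fb)|exact: bmr_normc|].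
move=> z _; apply: le_trans (ler_norm _) _.
by rewrite (le_trans (abs_Re_le _))// normcM u1 mul1r.
Qed.

End Means.

(** * Fourier coefficients *)

Section FourierCoefficients.
Variable R : realType.
Implicit Types (z u v : R[i]) (g h : R[i] -> R) (f : R[i] -> R[i]) (t : R).
Local Notation mu := (@lebesgue_measure R).
Local Notation dom := (circ_dom R).

Lemma expiX t k : expi t ^+ k = expi (k%:R * t).
Proof.
elim: k => [|k IH]; first by rewrite expr0 mul0r /expi cos0 sin0.
rewrite exprS IH /expi -nat1r mulrDl mul1r cosD sinD.
by apply/eqP; rewrite eq_complex /=; apply/andP; split; apply/eqP; ring.
Qed.

Lemma expi_2pi : expi (2 * pi : R) = 1.
Proof. by rewrite /expi mulr_natl cos2pi sin2pi. Qed.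

Lemma bmc_id : bmc (fun z : R[i] => z).
Proof.
split; split => /=.
- by apply: measurable_funTS; apply: continuous_measurable_fun; exact: continuous_cos.
- by exists 1 => z <-; exact: abs_Re_le.
- by apply: measurable_funTS; apply: continuous_measurable_fun; exact: continuous_sin.
- by exists 1 => z <-; exact: abs_Im_le.
Qed.

Lemma bmc_exprn k : bmc (fun z : R[i] => z ^+ k).
Proof.
elim: k => [|k IH]; first by apply: bmc_ext (bmc_cst 1) _ => z _; rewrite expr0.
by apply: bmc_ext (bmcM bmc_id IH) _ => z _; rewrite exprS.
Qed.

Lemma bmc_exprz n : bmc (fun z : R[i] => z ^ n).
Proof.
case: n => k; first exact: bmc_exprn.
apply: bmc_ext (bmc_conj (bmc_exprn k.+1)) _ => z z1.
by rewrite unit_conj// normcX z1 expr1n.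
Qed.

Lemma Rintegral_period (F f : R -> R) : continuous f ->
  (forall t, is_derive t 1 F (f t)) -> F (2 * pi) = F 0 ->
  Rintegral mu dom f = 0.
Proof.
move=> cf dF Fper; rewrite /Rintegral /circ_dom (@continuous_FTC2 _ f F) //.
- by rewrite Fper subee.
- exact: pi2_gt0.
- exact: continuous_subspaceT.
- have cF : continuous F.
    by move=> x; apply: differentiable_continuous; apply/derivable1_diffP; case: (dF x).
  split; first by move=> x _; case: (dF x).
  + by apply: cvg_at_right_filter; exact: cF.
  + by apply: cvg_at_left_filter; exact: cF.
- by move=> x _; rewrite derive1E; exact: derive_val.
Qed.

Lemma is_derive_dilate (phi : R -> R) (c d t : R) : is_derive (c * t) 1 phi d ->
  is_derive t 1 (fun t => phi (c * t)) (c * d).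
Proof.
move=> dphi.
have dct : is_derive t (1 : R) ( *%R c : R -> R) (c * 1).
  exact: (@is_deriveZ R R^o R^o id c t 1 1 (is_derive_id _ _)).
have := @is_derive1_comp R phi ( *%R c) t d (c * 1) dphi dct.
by rewrite mulr1 mulrC; exact.
Qed.

Lemma circ_int_exprn k : circ_int (fun z : R[i] => z ^+ k.+1) = 0.
Proof.
pose c : R := k.+1%:R; have c0 : c != 0 by rewrite pnatr_eq0.
have ck : continuous ( *%R c) by exact: mulrl_continuous.
have dil phi d t : is_derive (c * t) 1 phi d ->
    is_derive t 1 (fun t => c^-1 * phi (c * t)) d.
  move=> /is_derive_dilate H.
  have := @is_deriveZ R R^o R^o _ c^-1 t 1 _ H.
  by rewrite /GRing.scale/= mulrA mulVf// mul1r; exact.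
have per : expi (c * (2 * pi)) = 1 by rewrite -expiX expi_2pi expr1n.
have cper : cos (c * (2 * pi)) = 1 by exact: (congr1 (@complex.Re R) per).
have sper : sin (c * (2 * pi)) = 0 by exact: (congr1 (@complex.Im R) per).
suff [re im] : rmean (fun z : R[i] => complex.Re (z ^+ k.+1)) = 0 /\
    rmean (fun z : R[i] => complex.Im (z ^+ k.+1)) = 0.
  by rewrite circ_intE re im.
have rmeanE g (h : R -> R) : (forall t, g (expi t) = h t) -> Rintegral mu dom h = 0 ->
    rmean g = 0.
  move=> gh h0; rewrite /rmean (_ : (fun t => g (expi t)) = h) ?h0 ?mulr0//.
  by apply/funext.
split.
  apply: (rmeanE _ (fun t => cos (c * t))); first by move=> t; rewrite expiX.
  have dF t : is_derive t 1 (fun t => c^-1 * sin (c * t)) (cos (c * t)).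
    by apply: dil; exact: is_derive_sin.
  apply: Rintegral_period dF _; last by rewrite sper !mulr0 sin0 mulr0.
  by move=> t; apply: continuous_comp; [exact: ck|exact: continuous_cos].
apply: (rmeanE _ (fun t => sin (c * t))); first by move=> t; rewrite expiX.
have dF t : is_derive t 1 (fun t => c^-1 * (- cos (c * t))) (sin (c * t)).
  apply: (dil (fun t => - cos t)).
  have := @is_deriveN R R^o R^o cos (c * t) 1 _ (is_derive_cos _).
  by rewrite opprK; exact.
apply: Rintegral_period dF _; last by rewrite cper mulr0 cos0.
by move=> t; apply: continuous_comp; [exact: ck|exact: continuous_sin].
Qed.

Lemma circ_int_exprz n : circ_int (fun z : R[i] => z ^ n) = (n == 0)%:R.
Proof.
case: n => [[|k]|k].
- by rewrite -[RHS](circ_int_cst 1); apply: circ_int_ext => z _; rewrite expr0z.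
- exact: circ_int_exprn.
- rewrite (@circ_int_ext _ _ (fun z => conjc (z ^+ k.+1))); last first.
    by move=> z z1; rewrite unit_conj// normcX z1 expr1n.
  by rewrite circ_int_conj ?circ_int_exprn ?conjc0//; exact: bmc_exprn.
Qed.

Lemma bmc_monomial u n : bmc (fun z => u * z ^ n).
Proof. exact/bmcZ/bmc_exprz. Qed.

Lemma bmc_trig (s : seq (R[i] * int)) : bmc (trig s).
Proof. by apply: bmc_sum => m; exact: bmc_monomial. Qed.

Lemma bmc_tpoly P f : tpoly P f -> bmc f.
Proof.
move=> [Q [s [_ _ fs]]]; apply: bmc_ext (bmc_trig s) _ => z z1.
by rewrite fs.
Qed.

Lemma fourier_ext f f' n : (forall z, normc z = 1 -> f z = f' z) ->
  fourier f n = fourier f' n.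
Proof. by move=> ff; apply: circ_int_ext => z z1; rewrite ff. Qed.

Lemma fourier_bmc f n : bmc f -> bmc (fun z => f z * z ^ (- n)).
Proof. by move=> fb; apply: bmcM fb _; exact: bmc_exprz. Qed.

Lemma fourierD f f' n : bmc f -> bmc f' ->
  fourier (fun z => f z + f' z) n = fourier f n + fourier f' n.
Proof.
move=> fb fb'; rewrite /fourier -circ_intD; try exact: fourier_bmc.
by apply: circ_int_ext => z _; rewrite mulrDl.
Qed.

Lemma fourierZ u f n : bmc f -> fourier (fun z => u * f z) n = u * fourier f n.
Proof.
move=> fb; rewrite /fourier -circ_intZ; last exact: fourier_bmc.
by apply: circ_int_ext => z _; rewrite mulrA.
Qed.

Lemma fourierB f f' n : bmc f -> bmc f' ->
  fourier (fun z => f z - f' z) n = fourier f n - fourier f' n.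
Proof.
move=> fb fb'; rewrite /fourier -circ_intB; try exact: fourier_bmc.
by apply: circ_int_ext => z _; rewrite mulrBl.
Qed.

Lemma fourier_sum I (r : seq I) (F : I -> R[i] -> R[i]) n :
  (forall i, bmc (F i)) ->
  fourier (fun z => \sum_(i <- r) F i z) n = \sum_(i <- r) fourier (F i) n.
Proof.
move=> Fb; rewrite /fourier -circ_int_sum; last by move=> i; exact: fourier_bmc.
by apply: circ_int_ext => z _; rewrite mulr_suml.
Qed.

Lemma fourierMexprz f k n : fourier (fun z => f z * z ^ k) n = fourier f (n - k).
Proof.
apply: circ_int_ext => z z1.
by rewrite -mulrA -unit_exprzD// opprB [k - n]addrC [- n + k]addrC.
Qed.

Lemma fourier_conj f n : bmc f ->
  fourier (fun z => conjc (f z)) n = conjc (fourier f (- n)).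
Proof.
move=> fb; rewrite /fourier -circ_int_conj; last exact: fourier_bmc.
by apply: circ_int_ext => z z1; rewrite rmorphM/= unit_conj_exprz// opprK.
Qed.

Lemma fourier0 f : fourier f 0 = circ_int f.
Proof. by apply: circ_int_ext => z _; rewrite oppr0 expr0z mulr1. Qed.

Lemma normc_fourier_le f n : bmc f ->
  normc (fourier f n) <= rmean (fun z => normc (f z)).
Proof.
move=> fb; apply: le_trans (normc_circ_int_le (fourier_bmc n fb)) _.
rewrite le_eqVlt; apply/orP; left; apply/eqP; apply: rmean_ext => z z1.
by rewrite normcM normc_exprz// mulr1.
Qed.

Lemma fourier_trig (s : seq (R[i] * int)) n :
  fourier (trig s) n = \sum_(m <- s | m.2 == n) m.1.
Proof.
rewrite fourier_sum; last by move=> m; exact: bmc_monomial.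
rewrite [RHS]big_mkcond; apply: eq_bigr => -[u k] _ /=.
rewrite fourierZ; last exact: bmc_exprz.
rewrite (@fourier_ext _ (fun z => 1 * z ^ k)); last by move=> z _; rewrite mul1r.
rewrite fourierMexprz /fourier (@circ_int_ext _ _ (fun z => z ^ (k - n))).
  by rewrite circ_int_exprz subr_eq0; case: eqP => _; rewrite ?mulr1 ?mulr0.
by move=> z _; rewrite mul1r opprB.
Qed.

Lemma tpoly_fourier_eq0 (P : pred int) f n : tpoly P f -> ~~ P n ->
  fourier f n = 0.
Proof.
move=> [Q [s [Ps _ fs]]] Pn; rewrite (fourier_ext _ fs) fourier_trig.
rewrite big_seq_cond big1// => m /andP[ms /eqP mn].
by move: Pn; rewrite -mn (allP Ps _ ms).
Qed.

(** Collecting the monomials of equal frequency. *)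
Lemma tpoly_expand (P : pred int) f : tpoly P f -> exists r : seq int,
  [/\ uniq r, {subset r <= P} &
      forall z, normc z = 1 -> f z = \sum_(k <- r) fourier f k * z ^ k].
Proof.
move=> [Q [s [Ps _ fs]]]; exists (undup (map snd s)); split.
- exact: undup_uniq.
- by move=> k; rewrite mem_undup => /mapP[m ms ->]; exact: (allP Ps).
- move=> z z1; rewrite fs// /trig.
  under [RHS]eq_bigr => k _ do
    rewrite (fourier_ext _ fs) fourier_trig big_mkcond mulr_suml.
  rewrite exchange_big /=; apply: eq_big_seq => -[u k] ms /=.
  have kr : k \in undup (map snd s) by rewrite mem_undup; apply/mapP; exists (u, k).
  rewrite (bigD1_seq k)//= ?undup_uniq// eqxx big1 ?addr0// => j jk.
  by rewrite eq_sym (negbTE jk) mul0r.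
Qed.

Lemma wpoly_fourier_le w Q P f (r : seq int) : even_weight w -> uniq r ->
  wpoly w Q P f -> \sum_(k <- r) normc (fourier f k) * w k <= Q.
Proof.
move=> [w1 _ _] ur [s [_ Qs fs]]; apply: le_trans Qs.
have w0 k : 0 <= w k by exact: le_trans (w1 k).
have term0 (m : R[i] * int) : 0 <= normc m.1 * w m.2 by rewrite mulr_ge0// normc_ge0.
apply: (@le_trans _ _ (\sum_(k <- r) \sum_(m <- s | m.2 == k) normc m.1 * w m.2)).
  apply: ler_sum => k _; rewrite (fourier_ext _ fs) fourier_trig.
  apply: (@le_trans _ _ ((\sum_(m <- s | m.2 == k) normc m.1) * w k)).
    rewrite ler_wpM2r// big_mkcond [leRHS]big_mkcond.
    apply: le_trans (normc_sum _ _) _; apply: ler_sum => m _.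
    by case: eqP => // _; rewrite (@normc0 R).
  by rewrite mulr_suml; apply: ler_sum => m /eqP ->.
under eq_bigr do rewrite big_mkcond.
rewrite exchange_big /=; apply: ler_sum => m _.
have [mr|mr] := boolP (m.2 \in r).
  rewrite (bigD1_seq m.2)//= eqxx big1 ?addr0// => j jm.
  by rewrite eq_sym (negbTE jm).
rewrite big_seq_cond big1// => j /andP[jr _].
by case: eqP mr => // ->; rewrite jr.
Qed.

End FourierCoefficients.

(** * Logarithm and exponential estimates *)

Section LogSeries.
Variable R : realType.
Implicit Types (x y t : R) (k : nat).

Definition log_series k x : R := \sum_(m < k) x ^+ m.+1 / m.+1%:R.

Lemma log_series_ge0 k x : 0 <= x -> 0 <= log_series k x.
Proof. by move=> x0; apply: sumr_ge0 => m _; rewrite divr_ge0// exprn_ge0. Qed.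

Lemma le_log_series k x y : 0 <= x -> x <= y -> log_series k x <= log_series k y.
Proof.
move=> x0 xy; apply: ler_sum => m _; rewrite ler_wpM2r ?invr_ge0//.
by rewrite lerXn2r// nnegrE ?(le_trans x0).
Qed.

Lemma is_derive_log_series k x : is_derive x 1 (log_series k) (\sum_(m < k) x ^+ m).
Proof.
have -> : log_series k = \sum_(m < k) ((m.+1%:R^-1 : R) \*: (id ^+ m.+1) : R -> R).
  apply/funext => y; rewrite /log_series fct_sumE; apply: eq_bigr => m _.
  by rewrite /= exprfctE mulrC.
apply: is_derive_eq; apply: eq_bigr => m _.
by rewrite /GRing.scale/= mulr1 mulrA mulVf ?mul1r// pnatr_eq0.
Qed.

(** The remainder of the series has derivative [x ^ k / (1 - x)], which lies
    between [0] and [2 / 2 ^ k] on the interval in question. *)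
Lemma log_series_bounds k x : 0 <= x -> x <= 2^-1 ->
  log_series k x <= - ln (1 - x) <= log_series k x + 2^-1 ^+ k.
Proof.
move=> x0 x2.
pose d (y : R) := - ln (1 - y) - log_series k y.
pose d' (y : R) := y ^+ k / (1 - y).
have dd (y : R) : y < 1 -> is_derive y 1 d (d' y).
  move=> y1.
  have dl : is_derive y 1 (fun y : R => ln (1 - y)) (- (1 - y)^-1).
    have l1 : is_derive (1 - y) 1 (@ln R) (1 - y)^-1.
      by apply: is_derive1_ln; rewrite subr_gt0.
    have l2 : is_derive y 1 (fun y : R => 1 - y) (0 - 1).
      exact: (@is_deriveB R R^o R^o (cst 1) id y 1 0 1).
    have := @is_derive1_comp R (@ln R) (fun y : R => 1 - y) y _ _ l1 l2.
    by rewrite sub0r mulrN1; exact.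
  have := @is_deriveB R R^o R^o _ _ y 1 _ _ (is_deriveN dl) (is_derive_log_series k y).
  rewrite opprK; have -> : (1 - y)^-1 - \sum_(m < k) y ^+ m = d' y.
    rewrite /d'; have y0 : 1 - y != 0 by rewrite subr_eq0 gt_eqF.
    apply: (mulfI y0); rewrite mulrBr divff// mulrCA divff// mulr1.
    by have := subrX1 y k; rewrite -[1 - y]opprB mulNr => <-; ring.
  by [].
have lt1 (y : R) : y <= x -> y < 1.
  by move=> yx; apply: le_lt_trans yx (le_lt_trans x2 _); rewrite invf_lt1// ltr1n.
have dI y : y \in `]0, x[%R -> is_derive y 1 d (d' y).
  by rewrite in_itv/= => /andP[_ /ltW /lt1]; exact: dd.
have cI : {within `[0, x], continuous d}.
  apply: derivable_within_continuous => y; rewrite in_itv/= => /andP[_ /lt1 /dd].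
  by case.
have [c + dc] := MVT_segment x0 dI cI.
rewrite in_itv/= => /andP[c0 cx].
have d0 : d 0 = 0.
  rewrite /d subr0 ln1 oppr0 sub0r /log_series big1 ?oppr0// => m _.
  by rewrite expr0n mul0r.
rewrite d0 !subr0 in dc.
have c2 : c <= 2^-1 by exact: le_trans x2.
have c1 : 2^-1 <= 1 - c by lra.
have d'c : 0 <= d' c <= 2 * 2^-1 ^+ k.
  rewrite /d' divr_ge0 ?exprn_ge0//= ?(le_trans _ c1)//.
  rewrite mulrC ler_pM ?exprn_ge0 ?invr_ge0 ?(le_trans _ c1)//.
    by rewrite -[leRHS]invrK lef_pV2 ?posrE// (lt_le_trans _ c1).
  by rewrite lerXn2r// nnegrE.
have /andP[dc0 dc1] := d'c.
have : 0 <= d x <= 2^-1 ^+ k.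
  rewrite dc mulr_ge0//=; apply: le_trans (ler_pM dc0 x0 dc1 x2) _.
  by rewrite mulrAC mulfV ?mul1r.
by rewrite /d; lra.
Qed.

Lemma expR_le_inv x : x < 1 -> expR x <= (1 - x)^-1.
Proof.
move=> x1; rewrite -[expR x]invrK -expRN lef_pV2 ?posrE ?expR_gt0 ?subr_gt0//.
exact: expR_ge1Dx.
Qed.

Lemma expR_le12 x : 0 <= x -> x <= 2^-1 -> expR x <= 1 + 2 * x.
Proof.
move=> x0 x2; apply: le_trans (expR_le_inv _) _; first by lra.
rewrite -[leLHS]mul1r ler_pdivrMr; last by lra.
by nra.
Qed.

Lemma ln_ge1BV x : 0 < x -> 1 - x^-1 <= ln x.
Proof.
move=> x0; have := @expR_ge1Dx R (- ln x).
by rewrite expRN lnK ?posrE//; lra.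
Qed.

(** Compound interest from below, from [1 + u >= exp (u / (1 + u))]. *)
Lemma compound_ge k x : 0 <= x -> expR (x - x ^+ 2 / k.+1%:R) <= (1 + x / k.+1%:R) ^+ k.+1.
Proof.
move=> x0; pose N : R := k.+1%:R; have N0 : 0 < N by rewrite ltr0n.
rewrite -/N; pose u := x / N; have u0 : 0 <= u by rewrite divr_ge0// ltW.
apply: (@le_trans _ _ (expR (N * (u / (1 + u))))).
  rewrite ler_expR -/u.
  have -> : x = N * u by rewrite /u mulrCA divff ?mulr1// gt_eqF.
  have -> : (N * u) ^+ 2 / N = N * u ^+ 2 by field; rewrite gt_eqF.
  rewrite -mulrBr ler_pM2l// ler_pdivlMr; last by lra.
  have -> : (u - u ^+ 2) * (1 + u) = u - u ^+ 3 by ring.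
  by have := exprn_ge0 3 u0; lra.
rewrite expRM_natl lerXn2r// ?nnegrE ?expR_ge0 ?addr_ge0//.
have u1 : u / (1 + u) < 1 by rewrite ltr_pdivrMr; lra.
apply: le_trans (expR_le_inv u1) _; rewrite le_eqVlt; apply/orP; left; apply/eqP.
rewrite -/u; clearbody u; have u1' : 1 + u != 0 by rewrite gt_eqF// ltr_wpDr.
by field; rewrite u1'; rewrite addrK oner_neq0.
Qed.

Lemma compound_le k x : 0 <= 1 + x / k.+1%:R -> (1 + x / k.+1%:R) ^+ k.+1 <= expR x.
Proof.
move=> x0; have -> : expR x = expR (x / k.+1%:R) ^+ k.+1.
  by rewrite -expRM_natl mulrCA divff ?mulr1// pnatr_eq0.
rewrite lerXn2r// ?nnegrE ?expR_ge0//; exact: expR_ge1Dx.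
Qed.

End LogSeries.

(** * Spectral factorization by trigonometric polynomials *)

Section SpectralFactorization.
Variable R : realType.
Implicit Types (z u v : R[i]) (f g : R[i] -> R[i]) (w : int -> R) (Q : R).

Let nonneg : pred int := fun k => 0 <= k.

Lemma RealM (t : R) z : complex.Re (real_complex R t * z) = t * complex.Re z.
Proof. by case: z => x y /=; rewrite mul0r subr0. Qed.

Lemma Re_sum I (r : seq I) (F : I -> R[i]) :
  complex.Re (\sum_(i <- r) F i) = \sum_(i <- r) complex.Re (F i).
Proof.
elim: r => [|i r IH]; first by rewrite !big_nil.
by rewrite !big_cons -IH; case: (F i) => a b; case: (\sum_(_ <- _) _).
Qed.

(** Frequencies [n] and [- n] have the same weight, so folding the negative
    ones onto the positive ones, with half of the constant term, halves the norm.
    This factor of two is what makes the threshold [1 / sqrt 2] possible. *)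
Lemma analytic_half w Q P f : even_weight w -> wpoly w Q P f ->
  exists l, [/\ wpoly w (Q / 2) nonneg l,
    forall z, normc z = 1 -> complex.Re (l z) = complex.Re (f z) / 2 &
    circ_int l = real_complex R (complex.Re (circ_int f) / 2)].
Proof.
move=> [w1 wN wD] [s [Ps Qs fs]].
(* 1/4 at 0, which is its own opposite, so that etaD holds there too *)
pose eta (n : int) : R := if 0 < n then 2^-1 else if n == 0 then 4^-1 else 0.
have eta_ge0 n : 0 <= eta n by rewrite /eta; case: ifP => // _; case: ifP.
have etaD n : eta n + eta (- n) = 2^-1.
  rewrite /eta oppr_gt0 oppr_eq0.
  by case: ltgtP => // _; rewrite ?addr0 ?add0r//; lra.
have eta_abs n : eta n = 0 \/ `|n| = n.
  rewrite /eta; case: ltgtP => n0; [by right; rewrite gtr0_norm|by left|].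
  by right; rewrite -n0 normr0.
have w_abs n : w `|n| = w n.
  by have [n0|n0] := leP 0 n; [rewrite ger0_norm|rewrite ltr0_norm// wN].
pose pos (m : R[i] * int) : R[i] * int := (real_complex R (eta m.2) * m.1, `|m.2|).
pose neg (m : R[i] * int) : R[i] * int :=
  (real_complex R (eta (- m.2)) * conjc m.1, `|m.2|).
pose r := map pos s ++ map neg s.
have rE z : trig r z = \sum_(m <- s) ((pos m).1 * z ^ `|m.2| + (neg m).1 * z ^ `|m.2|).
  by rewrite /trig big_cat !big_map big_split.
exists (trig r); split.
- exists r; split=> //.
    rewrite all_cat !all_map; apply/andP; split; apply/allP => m _ /=;
      by rewrite /nonneg normr_ge0.
  have -> : trig_norm w r =
      \sum_(m <- s) (normc (pos m).1 * w `|m.2| + normc (neg m).1 * w `|m.2|).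
    by rewrite /trig_norm big_cat !big_map big_split.
  apply: le_trans (_ : _ <= trig_norm w s / 2) _; last by rewrite ler_pM2r.
  rewrite /trig_norm mulr_suml; apply: ler_sum => m _.
  have -> : normc (pos m).1 = eta m.2 * normc m.1.
    by rewrite normcM normc_real ger0_norm.
  have -> : normc (neg m).1 = eta (- m.2) * normc m.1.
    by rewrite normcM normc_real ger0_norm// normc_conj.
  rewrite w_abs -!mulrDl etaD.
  by rewrite le_eqVlt; apply/orP; left; apply/eqP; ring.
- move=> z z1; rewrite rE fs// /trig !Re_sum mulr_suml; apply: eq_bigr => -[u n] _ /=.
  have E (t : R) v : complex.Re (real_complex R t * v * z ^ `|n|) =
      t * complex.Re (v * z ^ `|n|) by rewrite -mulrA RealM.
  have ReD (x y : R[i]) : complex.Re (x + y) = complex.Re x + complex.Re y.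
    by case: x; case: y.
  rewrite ReD !E.
  have -> : eta n * complex.Re (u * z ^ `|n|) = eta n * complex.Re (u * z ^ n).
    by have [->|->] := eta_abs n; rewrite ?mul0r.
  have -> : eta (- n) * complex.Re (conjc u * z ^ `|n|) =
      eta (- n) * complex.Re (u * z ^ n).
    have [->|] := eta_abs (- n); rewrite ?mul0r// normrN => ->.
    by rewrite -unit_conj_exprz// -rmorphM; case: (u * _).
  by rewrite -mulrDl etaD mulrC.
- rewrite (circ_int_ext fs) -!fourier0 !fourier_trig big_cat !big_map /=.
  have E : \sum_(i <- s | `|i.2| == 0) real_complex R (eta i.2) * i.1 =
      \sum_(i <- s | i.2 == 0) real_complex R 4^-1 * i.1.
    by apply: eq_big => [m|m]; rewrite normr_eq0// => /eqP ->.
  have E' : \sum_(i <- s | `|i.2| == 0) real_complex R (eta (- i.2)) * conjc i.1 =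
      \sum_(i <- s | i.2 == 0) real_complex R 4^-1 * conjc i.1.
    by apply: eq_big => [m|m]; rewrite normr_eq0// => /eqP ->; rewrite oppr0.
  rewrite E E' -!mulr_sumr.
  have -> : \sum_(i <- s | i.2 == 0) conjc i.1 = conjc (\sum_(i <- s | i.2 == 0) i.1).
    by rewrite rmorph_sum.
  case: (\sum_(i <- s | i.2 == 0) i.1) => x y.
  by apply/eqP; rewrite eq_complex /=; apply/andP; split; apply/eqP; field.
Qed.

(** The mean is the value at the centre of the disc: among the products
    [f * z ^ k] with [k >= 0], only the one with [k = 0] contributes to it. *)
Lemma circ_intM_analytic f g : bmc f ->
  (forall n : int, n < 0 -> fourier f n = 0) -> tpoly nonneg g ->
  circ_int (fun z => f z * g z) = circ_int f * circ_int g.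
Proof.
move=> fb f0 gt; have [r [ur rP gr]] := tpoly_expand gt.
have Fb k : bmc (fun z => fourier g k * (f z * z ^ k)).
  by apply: bmcZ; apply: bmcM fb _; exact: bmc_exprz.
rewrite (@circ_int_ext _ _ (fun z => \sum_(k <- r) fourier g k * (f z * z ^ k))).
  rewrite circ_int_sum//.
  rewrite [circ_int g](circ_int_ext gr) circ_int_sum; last first.
    by move=> k; exact: bmc_monomial.
  rewrite mulr_sumr; apply: eq_big_seq => k kr.
  rewrite !circ_intZ; [|exact: bmc_exprz|by apply: bmcM fb _; exact: bmc_exprz].
  rewrite circ_int_exprz mulrCA; congr (_ * _).
  have -> : circ_int (fun z => f z * z ^ k) = fourier f (- k).
    by apply: circ_int_ext => z _; rewrite opprK.
  have := rP _ kr; rewrite /in_mem /= /nonneg le_eqVlt => /orP[/eqP <-|k0].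
    by rewrite oppr0 fourier0 mulr1.
  by rewrite f0 ?oppr_lt0// gt_eqF// mulr0.
by move=> z z1; rewrite {1}gr// mulr_sumr; apply: eq_bigr => k _; rewrite mulrCA.
Qed.

Lemma tpoly_exp (P : pred int) g k : (forall i j, P i -> P j -> P (i + j)) -> P 0 ->
  tpoly P g -> tpoly P (fun z => g z ^+ k).
Proof.
move=> PD P0 gt; elim: k => [|k IH].
  by apply: tpoly_weak (tpoly_cst 1 P0) _ _ => // z _; rewrite expr0.
by apply: tpoly_weak (tpolyM PD gt IH) _ _ => // z _; rewrite exprS.
Qed.

Lemma circ_int_analytic_exp g k : tpoly nonneg g ->
  circ_int (fun z => g z ^+ k) = circ_int g ^+ k.
Proof.
move=> gt; have PD i j : nonneg i -> nonneg j -> nonneg (i + j) by exact: addr_ge0.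
elim: k => [|k IH].
  rewrite expr0 -[RHS](circ_int_cst 1).
  by apply: circ_int_ext => z _; rewrite expr0.
rewrite exprS -IH -circ_intM_analytic.
- by apply: circ_int_ext => z _; rewrite exprS.
- exact: bmc_tpoly gt.
- by move=> n n0; apply: tpoly_fourier_eq0 gt _; rewrite /nonneg -ltNge.
- exact: tpoly_exp.
Qed.

(** Multiplying the factors into [p] one at a time avoids the norm [w 0] of the
    constant function 1. *)
Lemma wpolyM_exp w Q B l p k : even_weight w -> 0 <= B ->
  wpoly w B nonneg l -> wpoly w Q xpredT p ->
  wpoly w (Q * (1 + B) ^+ k) xpredT (fun z => p z * (1 + l z) ^+ k).
Proof.
move=> ww B0 lB pQ; elim: k => [|k IH].
  by rewrite mulr1; apply: wpoly_weak pQ _ _ _ => // z _; rewrite expr0 mulr1.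
have lT : wpoly w B xpredT l by exact: wpoly_weak lB _ _ _.
have TT : forall i j : int, xpredT i -> xpredT j -> xpredT (i + j) by [].
have := wpolyD IH (wpolyM ww TT IH lT).
move=> /wpoly_weak; apply=> // [|z _]; rewrite exprSr.
  by rewrite le_eqVlt; apply/orP; left; apply/eqP; ring.
by ring.
Qed.

(** [g] stands for the exponential of the analytic half of
    [- log (1 - |p|^2)], with the logarithm replaced by a partial sum of its
    series and the exponential by a power [(1 + l / N) ^ N], so that it stays a
    trigonometric polynomial.  The norm is estimated for multiplication by
    [conj g] rather than for [g], because the constant function 1 has norm [w 0],
    which may exceed 1. *)
Lemma szego_approx w (beta : R) p k : even_weight w -> 0 <= beta ->
  beta ^+ 2 <= 2^-1 -> wpoly w beta xpredT p ->
  exists g, [/\ tpoly nonneg g,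
    forall z, normc z = 1 -> normc (g z) <= (Num.sqrt (1 - beta ^+ 2))^-1,
    forall Q q, 0 <= Q -> wpoly w Q xpredT q ->
      wpoly w (Q * (Num.sqrt (1 - beta ^+ 2))^-1) xpredT
        (fun z => q z * conjc (g z)),
    forall z, normc z = 1 ->
      normc (g z) ^+ 2 <= expR (k.+1%:R^-1) / (1 - normc (p z) ^+ 2) &
    exists2 m, circ_int g = real_complex R m &
      expR (rmean (fun z => log_series k.+1 (normc (p z) ^+ 2)) / 2 - k.+1%:R^-1)
        <= m].
Proof.
move=> ww b0 b2 pb.
pose f z := \sum_(m < k.+1)
  real_complex R m.+1%:R^-1 * (p z * conjc (p z)) ^+ m.+1.
pose l0 : R := log_series k.+1 (beta ^+ 2).
pose G : R := (Num.sqrt (1 - beta ^+ 2))^-1.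
have mulT Q1 Q2 f1 f2 : wpoly w Q1 xpredT f1 -> wpoly w Q2 xpredT f2 ->
    wpoly w (Q1 * Q2) xpredT (fun z => f1 z * f2 z) by exact: wpolyM.
have fE z : f z = real_complex R (log_series k.+1 (normc (p z) ^+ 2)).
  rewrite /f /log_series rmorph_sum; apply: eq_bigr => m _.
  by rewrite mul_conjc -rmorphXn/= -rmorphM mulrC.
have fw : wpoly w l0 xpredT f.
  have pp : wpoly w (beta ^+ 2) xpredT (fun z => p z * conjc (p z)).
    rewrite expr2; apply: mulT => //.
    exact: (wpoly_conj ww _ pb).
  have ppX m : wpoly w (beta ^+ 2 ^+ m.+1) xpredT (fun z => (p z * conjc (p z)) ^+ m.+1).
    elim: m => [|m IH]; first by apply: wpoly_weak pp _ _ _ => // z _; rewrite expr1.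
    have := mulT _ _ _ _ pp IH.
    by move=> /wpoly_weak; apply=> // [|z _]; rewrite exprS.
  rewrite /l0 /f /log_series; elim: (k.+1) => [|n IH].
    exists [::]; split=> //; first by rewrite /trig_norm big_nil big_ord0.
    by move=> z _; rewrite /trig big_nil big_ord0.
  have := wpolyD IH (wpolyZ (real_complex R n.+1%:R^-1) (ppX n)).
  move=> /wpoly_weak; apply=> // [|z _]; last by rewrite big_ord_recr.
  by rewrite big_ord_recr lerD2l normc_real ger0_norm ?invr_ge0// mulrC.
have [l [lw lre l_int]] := analytic_half ww fw.
pose N : R := k.+1%:R; have N0 : 0 < N by rewrite ltr0n.
have l0ge0 : 0 <= l0 by apply: log_series_ge0; exact: sqr_ge0.
have /andP[l0G _] := log_series_bounds k.+1 (sqr_ge0 beta) b2.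
have b21 : 0 < 1 - beta ^+ 2 by lra.
have l01 : l0 <= 1.
  apply: le_trans l0G _; have := ln_ge1BV b21.
  have : (1 - beta ^+ 2)^-1 <= 2.
    by rewrite -[leRHS]invrK lef_pV2 ?posrE// ?invr_gt0//; lra.
  by lra.
have GE : expR (l0 / 2) <= G.
  rewrite -[G]lnK ?posrE ?invr_gt0 ?sqrtr_gt0// ler_expR.
  rewrite lnV ?posrE ?sqrtr_gt0//.
  have : ln (1 - beta ^+ 2) = ln (Num.sqrt (1 - beta ^+ 2)) *+ 2.
    by rewrite -lnXn ?sqrtr_gt0// sqr_sqrtr// ltW.
  by rewrite mulr2n -/l0 in l0G *; lra.
have l_le z : normc z = 1 -> normc (l z) <= l0 / 2.
  by move=> z1; exact: wpoly_bound ww lw z1.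
pose mu_ z := real_complex R N^-1 * l z.
have muw : wpoly w (l0 / 2 / N) nonneg mu_.
  apply: wpoly_weak (wpolyZ (real_complex R N^-1) lw) _ _ _ => //.
  by rewrite normc_real ger0_norm ?invr_ge0 ?(ltW N0)// mulrC.
have B0 : 0 <= l0 / 2 / N by rewrite !divr_ge0// ltW.
have powG : (1 + l0 / 2 / N) ^+ k.+1 <= G.
  by apply: le_trans (compound_le _) GE; rewrite addr_ge0.
have gt1 : tpoly nonneg (fun z => 1 + mu_ z).
  by apply: tpolyD; [exact: tpoly_cst|exact: wpoly_tpoly ww muw].
have mut : tpoly nonneg mu_ := wpoly_tpoly ww muw.
have lt : tpoly nonneg l := wpoly_tpoly ww lw.
exists (fun z => (1 + mu_ z) ^+ k.+1); split.
- by apply: tpoly_exp => //; exact: addr_ge0.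
- move=> z z1; rewrite normcX; apply: le_trans powG.
  rewrite lerXn2r ?nnegrE ?normc_ge0 ?addr_ge0//.
  apply: le_trans (le_normcD _ _) _; rewrite (@normc1 R) lerD2l.
  exact: wpoly_bound ww muw z1.
- move=> Q q Q0 qw.
  have qcw : wpoly w Q xpredT (fun z => conjc (q z)) by exact: wpoly_conj ww _ qw.
  have := wpoly_conj (P' := xpredT) ww (fun _ _ => isT) (wpolyM_exp k.+1 ww B0 muw qcw).
  move=> /wpoly_weak; apply=> // [|z _]; first by rewrite ler_wpM2l.
  by rewrite rmorphM/= conjcK.
- move=> z z1; rewrite normcX -exprM mulnC exprM.
  have p2 : normc (p z) ^+ 2 <= beta ^+ 2.
    by rewrite lerXn2r ?nnegrE ?normc_ge0//; exact: wpoly_bound ww pb z1.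
  have p21 : 0 < 1 - normc (p z) ^+ 2 by lra.
  have -> : normc (1 + mu_ z) ^+ 2 =
      1 + (complex.Re (f z) + normc (l z) ^+ 2 / N) / N.
    rewrite !normc_sqr; have := lre z z1; rewrite /mu_; case: (l z) => x y /=.
    by move=> ->; field; rewrite gt_eqF.
  apply: le_trans (compound_le _) _.
    rewrite addr_ge0// divr_ge0// ?(ltW N0)// fE addr_ge0//.
      by apply: log_series_ge0; exact: sqr_ge0.
    by rewrite divr_ge0 ?sqr_ge0// ltW.
  rewrite addrC expRD ler_pM ?expR_ge0// ?ler_expR.
    rewrite ler_pdivrMr// mulVf ?gt_eqF//.
    have := l_le z z1; have := normc_ge0 (l z); have : l0 / 2 <= 1 by lra.
    by move=> ? ? ?; rewrite exprn_ile1//; lra.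
  rewrite -[leRHS]lnK ?posrE ?invr_gt0// ler_expR lnV ?posrE// fE /=.
  by have /andP[] := log_series_bounds k.+1 (sqr_ge0 (normc (p z))) (le_trans p2 b2).
- pose m0 : R := rmean (fun z => log_series k.+1 (normc (p z) ^+ 2)).
  have lm0 : circ_int l = real_complex R (m0 / 2).
    rewrite l_int; congr (real_complex R (_ / 2)).
    by rewrite circ_intE /=; apply: rmean_ext => z _; rewrite fE.
  have pbm : bmc p by exact: bmc_tpoly (wpoly_tpoly ww pb).
  have lsb : bmr (fun z => log_series k.+1 (normc (p z) ^+ 2)).
    have [] : bmc f by exact: bmc_tpoly (wpoly_tpoly ww fw).
    by move=> fr _; apply: bmr_ext fr _ => z _; rewrite fE.
  have m00 : 0 <= m0.
    by apply: rmean_ge0 lsb _ => z _; apply: log_series_ge0; exact: sqr_ge0.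
  have m02 : m0 <= 1.
    rewrite -[leRHS]rmean_cst; apply: le_rmean lsb (bmr_cst _) _ => z z1.
    apply: le_trans l01; apply: le_log_series; first exact: sqr_ge0.
    by rewrite lerXn2r ?nnegrE ?normc_ge0//; exact: wpoly_bound ww pb z1.
  exists ((1 + m0 / 2 / N) ^+ k.+1).
    rewrite circ_int_analytic_exp// circ_intD; [|exact: bmc_cst|exact: bmc_tpoly mut].
    rewrite circ_int_cst circ_intZ; last exact: bmc_tpoly lt.
    by rewrite lm0 -rmorphM -(rmorph1 (real_complex R)) -rmorphD -rmorphXn [_^-1 * _]mulrC.
  have m20 : 0 <= m0 / 2 by rewrite divr_ge0.
  apply: le_trans (compound_ge k m20); rewrite ler_expR lerD2l lerN2.
  by rewrite ler_pdivrMr// mulVf ?gt_eqF// exprn_ile1//; lra.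
Qed.

Lemma normc2B_real z (c : R[i]) : normc c = 1 ->
  normc (z - c) ^+ 2 = normc z ^+ 2 + 1 - 2 * complex.Re (conjc c * z).
Proof.
move=> c1; have := normc_sqr c; rewrite c1 expr1n !normc_sqr.
case: z c {c1} => x y [p q] /= E.
transitivity (x ^+ 2 + y ^+ 2 + (p ^+ 2 + q ^+ 2) - 2 * (p * x + q * y)); first by ring.
by rewrite -E; ring.
Qed.

(** In [L^2], the distance from [a^* g] to the unimodular constant [gamma] is
    [|a|^2 |g|^2 + 1 - 2 Re (conj gamma * a^* g)] on average.  The first term
    is controlled pointwise; in the last one the mean of the product is the
    product of the means, and outerness enters only through the value of
    [a^*] at the origin. *)
Lemma outer_inverse_approx w (beta : R) a b : even_weight w -> 0 <= beta ->
  beta ^+ 2 <= 2^-1 -> bmc a -> bmc b ->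
  (forall z, normc z = 1 -> normc (a z) ^+ 2 + normc (b z) ^+ 2 = 1) ->
  (forall z, normc z = 1 -> normc (b z) <= beta) ->
  (forall n : int, n < 0 -> fourier (fun z => conjc (a z)) n = 0) ->
  normc (circ_int a) = expR (rmean (fun z => ln (normc (a z)))) ->
  (forall eta, 0 < eta -> exists2 p, wpoly w beta xpredT p &
     rmean (fun z => normc (b z - p z)) <= eta) ->
  exists2 gamma, normc gamma = 1 & forall eta, 0 < eta -> exists g,
   [/\ tpoly nonneg g,
    forall z, normc z = 1 -> normc (g z) <= (Num.sqrt (1 - beta ^+ 2))^-1,
    forall Q q, 0 <= Q -> wpoly w Q xpredT q ->
      wpoly w (Q * (Num.sqrt (1 - beta ^+ 2))^-1) xpredT
        (fun z => q z * conjc (g z)) &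
    rmean (fun z => normc (conjc (a z) * g z - gamma)) <= eta].
Proof.
move=> ww b0 b2 abm bbm ab1 bb a_an a_out b_app.
pose A := circ_int (fun z => conjc (a z)).
have nA : normc A = expR (rmean (fun z => ln (normc (a z)))).
  by rewrite /A circ_int_conj// normc_conj.
have A0 : normc A != 0 by rewrite nA gt_eqF// expR_gt0.
pose gamma := A / real_complex R (normc A).
have g1 : normc gamma = 1.
  by rewrite normcM normcV normc_real ger0_norm ?normc_ge0// divff.
have gA : conjc gamma * A = real_complex R (normc A).
  have -> : conjc gamma = conjc A / real_complex R (normc A).
    rewrite /gamma; case: (A) => x y; apply/eqP.
    by rewrite eq_complex /=; apply/andP; split; apply/eqP; ring.
  rewrite mulrAC (mulrC _ A) mul_conjc expr2 rmorphM/= mulfK//.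
  by rewrite (inj_eq (@complexI R)).
exists gamma => // eta eta0.
(* the terms of the expanded square add up to at most 32 d *)
pose d : R := eta ^+ 2 / 32; have d0 : 0 < d by rewrite divr_gt0// exprn_gt0.
have [p pw bp] := b_app d d0.
pose k := Num.bound (d^-1 + 2).
have kd : k.+1%:R^-1 <= d /\ k.+1%:R^-1 <= 2^-1 :> R.
  have : d^-1 + 2 <= k.+1%:R.
    have := archi_boundP (addr_ge0 (ltW (_ : 0 < d^-1)) (ler0n R 2)).
    rewrite invr_gt0 => /(_ d0) /ltW kb; apply: le_trans kb _.
    by rewrite ler_nat.
  move=> kb; have di : 0 < d^-1 by rewrite invr_gt0.
  by split; rewrite -[leRHS]invrK lef_pV2 ?posrE ?invr_gt0 ?invrK//; lra.
have [g [gt gG gQ g2 [m gm m_ge]]] := szego_approx k ww b0 b2 pw.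
exists g; split=> //.
have pbm : bmc p by exact: bmc_tpoly (wpoly_tpoly ww pw).
have gbm : bmc g by exact: bmc_tpoly gt.
have dif_bm : bmr (fun z => normc (b z - p z)) by apply: bmr_normc; exact: bmcB.
have agbm : bmc (fun z => conjc (a z) * g z) by exact/bmcM/gbm/bmc_conj.
have errbm : bmc (fun z => conjc (a z) * g z - gamma) by exact/bmcB/bmc_cst.
have sq_dif z : normc z = 1 ->
    `|normc (p z) ^+ 2 - normc (b z) ^+ 2| <= 2 * normc (b z - p z).
  move=> z1; rewrite subr_sqr normrM mulrC ler_pM ?normc_ge0//; last first.
    by rewrite [leRHS]normcB normc_sub_ge.
  rewrite ger0_norm ?addr_ge0 ?normc_ge0//.
  have pz := wpoly_bound ww pw z1; have bz := bb z z1.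
  have : beta <= 1 by rewrite -(@expr_le1 _ 2)//; lra.
  by lra.
have half z : normc z = 1 -> [/\ normc (p z) ^+ 2 <= 2^-1, normc (b z) ^+ 2 <= 2^-1,
    0 <= normc (p z) ^+ 2 & 0 <= normc (b z) ^+ 2].
  move=> z1; split; rewrite ?sqr_ge0//; apply: le_trans b2;
    rewrite lerXn2r ?nnegrE ?normc_ge0//; [exact: wpoly_bound ww pw z1|exact: bb].
pose e : R := k.+1%:R^-1; have [ed e2] := kd; rewrite -/e in ed e2 m_ge g2.
have e0 : 0 <= e by rewrite invr_ge0.
have first_term : rmean (fun z => normc (conjc (a z) * g z) ^+ 2) <=
    (1 + 2 * e) * (1 + 4 * d).
  apply: (@le_trans _ _ (rmean (fun z => (1 + 2 * e) * (1 + 4 * normc (b z - p z))))).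
    apply: le_rmean; first exact: bmr_normc2.
      by apply: bmrZ; apply: bmrD; [exact: bmr_cst|exact: bmrZ].
    move=> z z1; rewrite normcM exprMn normc_conj.
    have [ph bh p0 bn0] := half z z1.
    apply: le_trans (ler_wpM2l (sqr_ge0 _) (g2 z z1)) _.
    rewrite mulrCA; apply: ler_pM; rewrite ?expR_ge0 ?expR_le12//.
      by rewrite divr_ge0 ?sqr_ge0//; lra.
    rewrite ler_pdivrMr; last by lra.
    have := sq_dif z z1; rewrite ler_norml => /andP[h1 h2].
    have := ab1 z z1; have := normc_ge0 (b z - p z).
    by move: h1 h2; nra.
  rewrite rmeanZ; last by apply: bmrD; [exact: bmr_cst|exact: bmrZ].
  rewrite rmeanD ?rmean_cst ?rmeanZ//; [|exact: bmr_cst|exact: bmrZ].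
  by rewrite ler_wpM2l ?lerD2l ?ler_wpM2l//; lra.
pose X := rmean (fun z => complex.Re (conjc gamma * (conjc (a z) * g z))).
have XE : X = normc A * m.
  have := circ_intZ (conjc gamma) agbm.
  rewrite (circ_intM_analytic (bmc_conj abm) a_an gt) -/A gm mulrA gA -rmorphM.
  by rewrite circ_intE => /(congr1 (@complex.Re R)).
have lnabm : bmr (fun z => ln (normc (a z))).
  apply: (bmr_comp (M := 1)); [exact: measurable_ln|exact: bmr_normc|].
  move=> z z1; have [_ bh _ bn0] := half z z1; have az := ab1 z z1.
  have a2 : 2^-1 <= normc (a z) ^+ 2 by lra.
  have a0 : 0 < normc (a z).
    rewrite lt0r normc_ge0 andbT; apply/eqP => a0.
    by rewrite a0 expr0n/= in a2; lra.
  have a1 : normc (a z) <= 1 by rewrite -(@expr_le1 _ 2) ?normc_ge0//; lra.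
  rewrite ler0_norm ?ln_le0//.
  have := ln_ge1BV (exprn_gt0 2 a0); rewrite lnXn// mulr2n.
  have : (normc (a z) ^+ 2)^-1 <= 2.
    by rewrite -[leRHS]invrK lef_pV2 ?posrE ?invr_gt0// exprn_gt0.
  by lra.
pose S z := log_series k.+1 (normc (p z) ^+ 2).
have Sbm : bmr S.
  have pp : bmr (fun z => normc (p z) ^+ 2) by exact: bmr_normc2.
  rewrite /S /log_series; elim: (k.+1) => [|n IH].
    by apply: bmr_ext (bmr_cst 0) _ => z _; rewrite big_ord0.
  have ppX j : bmr (fun z => (normc (p z) ^+ 2) ^+ j).
    elim: j => [|j IHj]; first by apply: bmr_ext (bmr_cst 1) _ => z _; rewrite expr0.
    by apply: bmr_ext (bmrM pp IHj) _ => z _; rewrite [RHS]exprS.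
  apply: bmr_ext (bmrD IH (bmrZ n.+1%:R^-1 (ppX n.+1))) _ => z _.
  by rewrite big_ord_recr/= [_^-1 * _]mulrC.
have pow2 : 2^-1 ^+ k.+1 <= e.
  rewrite /e exprVn lef_pV2 ?posrE ?exprn_gt0 ?ltr0n// -natrX ler_nat.
  exact/ltnW/ltn_expl.
have mean_log : - (2 * d) - e <= rmean (fun z => ln (normc (a z))) + rmean S / 2.
  have -> : rmean (fun z => ln (normc (a z))) + rmean S / 2 =
      rmean (fun z => ln (normc (a z)) + 2^-1 * S z).
    by rewrite rmeanD ?rmeanZ//; [rewrite mulrC|exact: bmrZ].
  apply: (@le_trans _ _ (rmean (fun z => (- 2) * normc (b z - p z) + - e))).
    rewrite rmeanD ?rmeanZ ?rmean_cst//; [|exact: bmrZ|exact: bmr_cst].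
    by lra.
  apply: le_rmean.
  - by apply: bmrD; [exact: bmrZ|exact: bmr_cst].
  - by apply: bmrD; [|exact: bmrZ].
  move=> z z1; have [ph bh p0 bn0] := half z z1; have az := ab1 z z1.
  have a2 : 0 < normc (a z) ^+ 2 by lra.
  have a0 : 0 < normc (a z).
    by rewrite lt0r normc_ge0 andbT; apply: contraTneq a2 => ->; rewrite expr0n ltxx.
  have /andP[_ Sge] := log_series_bounds k.+1 p0 ph.
  have p10 : 0 < 1 - normc (p z) ^+ 2 by lra.
  have quot : 0 < normc (a z) ^+ 2 / (1 - normc (p z) ^+ 2) by rewrite divr_gt0.
  have := ln_ge1BV quot; rewrite ln_div ?posrE// lnXn// mulr2n invfM invrK.
  have : - (4 * normc (b z - p z)) <= 1 - (normc (a z) ^+ 2)^-1 * (1 - normc (p z) ^+ 2).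
    rewrite -(ler_pM2r a2) mulrBl mul1r mulrAC mulVf ?gt_eqF// mul1r.
    have := sq_dif z z1; rewrite ler_norml => /andP[h1 h2].
    have := normc_ge0 (b z - p z); move: h1 h2; nra.
  by rewrite -/(S z) in Sge; lra.
have X_ge : 1 - 2 * d - 2 * e <= X.
  rewrite XE nA; apply: le_trans (_ : _ <= expR (rmean (fun z => ln (normc (a z)))) *
    expR (rmean S / 2 - e)) _; last by rewrite ler_wpM2l ?expR_ge0.
  rewrite -expRD; apply: le_trans (expR_ge1Dx _); lra.
have err2 : rmean (fun z => normc (conjc (a z) * g z - gamma) ^+ 2) <= eta ^+ 2.
  rewrite (@rmean_ext _ _ (fun z => (normc (conjc (a z) * g z) ^+ 2 + 1) +
    (- 2) * complex.Re (conjc gamma * (conjc (a z) * g z)))); last first.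
    by move=> z _; rewrite normc2B_real// mulNr.
  have t1 : bmr (fun z => normc (conjc (a z) * g z) ^+ 2) by exact: bmr_normc2.
  have t2 : bmr (fun z => complex.Re (conjc gamma * (conjc (a z) * g z))).
    by apply: bmr_Re; exact: bmcZ.
  rewrite rmeanD; [|by apply: bmrD; [|exact: bmr_cst]|exact: bmrZ].
  rewrite rmeanD ?rmean_cst ?rmeanZ// -/X; last exact: bmr_cst.
  have -> : eta ^+ 2 = 32 * d by rewrite /d mulrC divfK.
  by move: first_term X_ge; nra.
have r0 : 0 <= rmean (fun z => normc (conjc (a z) * g z - gamma)).
  by apply: rmean_ge0 => [|z _]; [exact: bmr_normc|exact: normc_ge0].
rewrite -(@ler_pXn2r _ 2) ?nnegrE ?(ltW eta0)//.
exact: le_trans (rmean_sqr_le (bmr_normc errbm)) err2.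
Qed.

End SpectralFactorization.

(** * Square-integrable functions and null sets *)

Section NullSets.
Variable R : realType.
Implicit Types (z u v : R[i]) (g h : R[i] -> R) (f : R[i] -> R[i]).
Local Notation mu := (@lebesgue_measure R).
Local Notation dom := (circ_dom R).

Definition rmeas g : Prop := measurable_fun dom (fun t => g (expi t)).

Definition ae_circ (P : R[i] -> Prop) : Prop :=
  {ae mu, forall t, dom t -> P (expi t)}.

(** The counterpart of [rmean] for nonnegative functions that need not be
    integrable; the real-valued mean would send their infinite integrals to 0. *)
Definition emean g : \bar R :=
  ((2 * pi)^-1%:E * \int[mu]_(t in dom) (g (expi t))%:E)%E.

Let aeF : Filter (almost_everywhere mu).
Proof. exact: ae_filter_ringOfSetsType. Qed.

Lemma ae_circS (P Q : R[i] -> Prop) : (forall z, normc z = 1 -> P z -> Q z) ->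
  ae_circ P -> ae_circ Q.
Proof.
rewrite /ae_circ => PQ; apply: (@filterS _ _ aeF) => t Pt /Pt; apply: PQ.
exact: normc_expi.
Qed.

Lemma ae_circI (P Q : R[i] -> Prop) : ae_circ P -> ae_circ Q ->
  ae_circ (fun z => P z /\ Q z).
Proof.
rewrite /ae_circ; apply: (@filterS2 _ _ aeF) => t Pt Qt Dt.
by split; [exact: Pt|exact: Qt].
Qed.

Lemma rmean_ae g h : rmeas g -> rmeas h -> ae_circ (fun z => g z = h z) ->
  rmean g = rmean h.
Proof.
move=> mg mh gh; rewrite /rmean /Rintegral; congr (_ * fine _).
apply: ae_eq_integral;
  [exact: measurable_circ_dom|exact/measurable_EFinP|exact/measurable_EFinP|].
by move: gh; apply: (@filterS _ _ aeF) => t gt Dt; rewrite /= gt.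
Qed.

Lemma circ_int_ae f f' : circ_measurable f -> circ_measurable f' ->
  ae_circ (fun z => f z = f' z) -> circ_int f = circ_int f'.
Proof.
move=> [fr fi] [fr' fi'] ff; rewrite !circ_intE; congr Complex.
  by apply: rmean_ae fr fr' _; apply: ae_circS ff => z _ ->.
by apply: rmean_ae fi fi' _; apply: ae_circS ff => z _ ->.
Qed.

Lemma emean_ae g h : rmeas g -> rmeas h -> ae_circ (fun z => g z = h z) ->
  emean g = emean h.
Proof.
move=> mg mh gh; rewrite /emean; congr (_ * _)%E.
apply: ae_eq_integral;
  [exact: measurable_circ_dom|exact/measurable_EFinP|exact/measurable_EFinP|].
by move: gh; apply: (@filterS _ _ aeF) => t gt Dt; rewrite /= gt.
Qed.

Lemma le_emean g h : rmeas g -> rmeas h ->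
  (forall z, normc z = 1 -> 0 <= g z <= h z) -> (emean g <= emean h)%E.
Proof.
move=> mg mh gh; rewrite /emean lee_wpmul2l//.
  by rewrite lee_fin invr_ge0 ltW// pi2_gt0.
have gh' t : 0 <= g (expi t) <= h (expi t) by apply: gh; exact: normc_expi.
apply: ge0_le_integral;
  [exact: measurable_circ_dom| |exact/measurable_EFinP|exact/measurable_EFinP|].
- by move=> t _; rewrite lee_fin; case/andP: (gh' t).
- by move=> t _; rewrite lee_fin; case/andP: (gh' t).
Qed.

Lemma emean_bmr g : bmr g -> emean g = (rmean g)%:E.
Proof.
move=> gb; rewrite /emean /rmean EFinM; congr (_ * _)%E.
rewrite /Rintegral fineK//; apply: integrable_fin_num; last exact: bmr_int.
exact: measurable_circ_dom.
Qed.

Lemma emean_affine (c0 c1 : R) g : 0 <= c0 -> 0 <= c1 -> rmeas g ->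
  (forall z, normc z = 1 -> 0 <= g z) ->
  emean (fun z => c0 + c1 * g z) = (c0%:E + c1%:E * emean g)%E.
Proof.
move=> c00 c10 mg g0; have g0' t : 0 <= g (expi t) by apply: g0; exact: normc_expi.
have mg' : measurable_fun dom (fun t => (g (expi t))%:E) by exact/measurable_EFinP.
have g0E t : dom t -> (0 <= (g (expi t))%:E)%E by rewrite lee_fin.
have c1E t : dom t -> (0 <= c1%:E * (g (expi t))%:E)%E.
  by move=> Dt; rewrite mule_ge0// ?lee_fin.
rewrite /emean; under eq_integral do rewrite EFinD EFinM.
have mc1 : measurable_fun dom (fun t => (c1%:E * (g (expi t))%:E)%E).
  exact: measurable_funeM.
have c0E (t : R) : dom t -> (0 <= c0%:E)%E by rewrite lee_fin.
have -> : (\int[mu]_(t in dom) (c0%:E + c1%:E * (g (expi t))%:E))%E =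
    (\int[mu]_(t in dom) (cst c0%:E) t + \int[mu]_(t in dom) (c1%:E * (g (expi t))%:E))%E.
  exact: (@ge0_integralD _ _ _ mu dom (@measurable_circ_dom R) (cst c0%:E)
    (fun t => c1%:E * (g (expi t))%:E)%E c0E (measurable_cst _) c1E mc1).
have -> : (\int[mu]_(t in dom) (c1%:E * (g (expi t))%:E))%E =
    (c1%:E * \int[mu]_(t in dom) (g (expi t))%:E)%E.
  exact: (@ge0_integralZl _ _ _ mu dom (@measurable_circ_dom R)
    (fun t => (g (expi t))%:E) mg' c1%:E g0E c10).
rewrite ge0_muleDr; last 2 first.
- by apply: integral_ge0 => t _; rewrite lee_fin.
- by apply: mule_ge0; [rewrite lee_fin|apply: integral_ge0].
rewrite muleCA; congr (_ + _)%E.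
rewrite integral_cst; last exact: measurable_circ_dom.
rewrite [X in (_ * (_ * X))%E](_ : _ = (2 * pi)%:E); last exact: circ_dom_measure.
by rewrite -!EFinM mulrCA mulVf ?mulr1// gt_eqF//; exact: pi2_gt0.
Qed.

Lemma emeanD g h : rmeas g -> rmeas h -> (forall z, normc z = 1 -> 0 <= g z) ->
  (forall z, normc z = 1 -> 0 <= h z) ->
  emean (fun z => g z + h z) = (emean g + emean h)%E.
Proof.
move=> mg mh g0 h0.
have g0' t : 0 <= g (expi t) by apply: g0; exact: normc_expi.
have h0' t : 0 <= h (expi t) by apply: h0; exact: normc_expi.
have g0E t : dom t -> (0 <= (g (expi t))%:E)%E by rewrite lee_fin.
have h0E t : dom t -> (0 <= (h (expi t))%:E)%E by rewrite lee_fin.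
rewrite /emean; under eq_integral do rewrite EFinD.
have mE (f : R[i] -> R) : rmeas f -> measurable_fun dom (fun t => (f (expi t))%:E).
  by move=> mf; exact/measurable_EFinP.
have -> : (\int[mu]_(t in dom) ((g (expi t))%:E + (h (expi t))%:E))%E =
    (\int[mu]_(t in dom) (g (expi t))%:E + \int[mu]_(t in dom) (h (expi t))%:E)%E.
  exact: (@ge0_integralD _ _ _ mu dom (@measurable_circ_dom R)
    (fun t => (g (expi t))%:E) (fun t => (h (expi t))%:E) g0E (mE _ mg) h0E (mE _ mh)).
by rewrite ge0_muleDr//; apply: integral_ge0 => t _; rewrite lee_fin.
Qed.

Lemma emean_ge0 g : (forall z, normc z = 1 -> 0 <= g z) -> (0 <= emean g)%E.
Proof.
move=> g0; rewrite mule_ge0//; first by rewrite lee_fin invr_ge0 ltW// pi2_gt0.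
by apply: integral_ge0 => t _; rewrite lee_fin; apply: g0; exact: normc_expi.
Qed.

Lemma emean_eq0 g : rmeas g -> (forall z, normc z = 1 -> 0 <= g z) ->
  (forall eta, 0 < eta -> (emean g <= eta%:E)%E) -> ae_circ (fun z => g z = 0).
Proof.
move=> mg g0 small; have g0' t : 0 <= g (expi t) by apply: g0; exact: normc_expi.
have e0 : emean g = 0%E.
  apply/eqP; rewrite eq_le emean_ge0// andbT; apply/lee_addgt0Pr => e e0.
  by rewrite add0e; exact: small.
have i0 : (\int[mu]_(t in dom) (g (expi t))%:E = 0)%E.
  move/eqP: e0; rewrite /emean mule_eq0 => /orP[|/eqP//].
  by rewrite eqe invr_eq0 gt_eqF// pi2_gt0.
have mgE : measurable_fun dom (fun t => (g (expi t))%:E) by exact/measurable_EFinP.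
have [H _] := @ae_eq_integral_abs _ _ _ mu dom (@measurable_circ_dom R) _ mgE.
have /H : (\int[mu]_(t in dom) `|(g (expi t))%:E| = 0)%E.
  by rewrite -[RHS]i0; apply: eq_integral => t _; rewrite gee0_abs// lee_fin.
by apply: (@filterS _ _ aeF) => t Ht Dt; have [] := Ht Dt.
Qed.

Lemma rmeas_bmr g : bmr g -> rmeas g.
Proof. by case. Qed.

Lemma rmeasD g h : rmeas g -> rmeas h -> rmeas (fun z => g z + h z).
Proof. exact: measurable_funD. Qed.

Lemma rmeasM g h : rmeas g -> rmeas h -> rmeas (fun z => g z * h z).
Proof. exact: measurable_funM. Qed.

Lemma rmeasB g h : rmeas g -> rmeas h -> rmeas (fun z => g z - h z).
Proof. exact: measurable_funB. Qed.

Lemma rmeas_cst (c : R) : rmeas (fun=> c).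
Proof. exact: measurable_cst. Qed.

Lemma rmeas_comp (phi : R -> R) g : measurable_fun setT phi -> rmeas g ->
  rmeas (fun z => phi (g z)).
Proof. by move=> mphi mg; exact: (measurableT_comp mphi mg). Qed.

Lemma rmeas_ext g h : rmeas g -> (forall z, normc z = 1 -> g z = h z) -> rmeas h.
Proof.
by move=> mg gh; apply: eq_measurable_fun mg => t _; rewrite gh// normc_expi.
Qed.

Lemma circ_meas_inv f : circ_measurable f ->
  rmeas (fun z => complex.Re (f z)) /\ rmeas (fun z => complex.Im (f z)).
Proof. by []. Qed.

Lemma circ_meas_ReIm f : rmeas (fun z => complex.Re (f z)) ->
  rmeas (fun z => complex.Im (f z)) -> circ_measurable f.
Proof. by []. Qed.

Lemma rmeas_normc2 f : circ_measurable f -> rmeas (fun z => normc (f z) ^+ 2).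
Proof.
move=> /circ_meas_inv[fr fi].
apply: rmeas_ext (rmeasD (rmeasM fr fr) (rmeasM fi fi)) _ => z _.
by rewrite normc_sqr !expr2.
Qed.

Lemma rmeas_normc f : circ_measurable f -> rmeas (fun z => normc (f z)).
Proof.
move=> /rmeas_normc2 f2; apply: (@rmeas_ext (fun z => Num.sqrt (normc (f z) ^+ 2))).
  apply: rmeas_comp f2; apply: continuous_measurable_fun; exact: sqrt_continuous.
by move=> z _; rewrite sqrtr_sqr ger0_norm// normc_ge0.
Qed.

Lemma bmc_meas f : bmc f -> circ_measurable f.
Proof. by move=> [[? _] [? _]]. Qed.

Lemma circ_measM f f' : circ_measurable f -> circ_measurable f' ->
  circ_measurable (fun z => f z * f' z).
Proof.
move=> /circ_meas_inv[fr fi] /circ_meas_inv[fr' fi']; apply: circ_meas_ReIm.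
  by apply: rmeas_ext (rmeasB (rmeasM fr fr') (rmeasM fi fi')) _ => z _;
    case: (f z); case: (f' z).
by apply: rmeas_ext (rmeasD (rmeasM fr fi') (rmeasM fi fr')) _ => z _;
    case: (f z); case: (f' z).
Qed.

Lemma circ_measB f f' : circ_measurable f -> circ_measurable f' ->
  circ_measurable (fun z => f z - f' z).
Proof.
move=> /circ_meas_inv[fr fi] /circ_meas_inv[fr' fi']; apply: circ_meas_ReIm.
  by apply: rmeas_ext (rmeasB fr fr') _ => z _; case: (f z); case: (f' z).
by apply: rmeas_ext (rmeasB fi fi') _ => z _; case: (f z); case: (f' z).
Qed.

Lemma circ_meas_conj f : circ_measurable f -> circ_measurable (fun z => conjc (f z)).
Proof.
move=> /circ_meas_inv[fr fi]; apply: circ_meas_ReIm.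
  by apply: rmeas_ext fr _ => z _; case: (f z).
by apply: rmeas_ext (rmeasB (rmeas_cst 0) fi) _ => z _; case: (f z) => x y; rewrite sub0r.
Qed.

(** With [good] the complement of a null set, this is a representative of [f]
    that satisfies everywhere what [f] satisfies almost everywhere. *)
Definition repair (good : pred R[i]) u f z : R[i] := if good z then f z else u.

Lemma circ_meas_repair (good : pred R[i]) u f :
  measurable_fun dom (fun t => good (expi t)) -> circ_measurable f ->
  circ_measurable (repair good u f).
Proof.
move=> mgood /circ_meas_inv[fr fi].
have aux (proj : R[i] -> R) : rmeas (fun z => proj (f z)) ->
    rmeas (fun z => proj (repair good u f z)).
  move=> mp; apply: (@rmeas_ext (fun z => if good z then proj (f z) else proj u)).
    apply: (@measurable_fun_if _ _ _ _ (fun t => proj (f (expi t)))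
      (fun=> proj u) dom (@measurable_circ_dom R) _ mgood).
      by apply: measurable_funS mp; [exact: measurable_circ_dom|exact: subIsetl].
    exact: measurable_cst.
  by move=> z _; rewrite /repair; case: ifP.
by split; exact: aux.
Qed.

Lemma bmc_bounded f M : circ_measurable f -> (forall z, normc z = 1 -> normc (f z) <= M) ->
  bmc f.
Proof.
move=> [fr fi] fM; split; split=> //; exists M => z z1.
  by apply: le_trans (fM z z1); exact: abs_Re_le.
by apply: le_trans (fM z z1); exact: abs_Im_le.
Qed.

Lemma bmc_repair (good : pred R[i]) u f M :
  measurable_fun dom (fun t => good (expi t)) -> circ_measurable f ->
  (forall z, normc z = 1 -> good z -> normc (f z) <= M) -> bmc (repair good u f).
Proof.
move=> mgood mf fM; apply: (bmc_bounded (M := Num.max M (normc u))).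
  exact: circ_meas_repair.
move=> z z1; rewrite /repair le_max; case: ifPn => gz; last by rewrite lexx orbT.
by rewrite fM.
Qed.

(** ** Convergence *)

Lemma L2_cvg_small (F : nat -> R[i] -> R[i]) f : L2_cvg F f ->
  forall eta, 0 < eta -> exists N0 : nat, forall N, (N0 <= N)%N ->
    (emean (fun z => (normc (F N z - f z) ^+ 2)%R) <= eta%:E)%E.
Proof.
move=> Ff eta eta0.
have := @cvgr_lt; have /fine_cvgP [fin_ cvg_] := Ff.
have [N1 _ H1] := fin_.
have /cvgr_lt /(_ eta eta0) [N2 _ H2] := cvg_.
move=> _; exists (maxn N1 N2) => N; rewrite geq_max => /andP[N1N N2N].
have fN : emean (fun z => normc (F N z - f z) ^+ 2) \is a fin_num := H1 N N1N.
rewrite -(fineK fN).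
by rewrite lee_fin ltW//; exact: H2.
Qed.

Lemma L2_cvg_rmean (F : nat -> R[i] -> R[i]) f f' : (forall N, bmc (F N)) ->
  circ_measurable f -> bmc f' -> ae_circ (fun z => f z = f' z) -> L2_cvg F f ->
  forall eta, 0 < eta -> exists N0 : nat, forall N, (N0 <= N)%N ->
    rmean (fun z => normc (F N z - f' z) ^+ 2) <= eta.
Proof.
move=> Fb mf fb' ff Ff eta eta0.
have [N0 N0P] := L2_cvg_small Ff eta0.
exists N0 => N /N0P; have db : bmc (fun z => F N z - f' z) by exact: bmcB.
rewrite (@emean_ae _ (fun z => normc (F N z - f' z) ^+ 2)); last 3 first.
- by apply: rmeas_normc2; apply: circ_measB => //; exact: bmc_meas.
- by apply: rmeas_normc2; exact: bmc_meas.
- by apply: ae_circS ff => z _ ->.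
by rewrite emean_bmr ?lee_fin//; exact: bmr_normc2.
Qed.

Lemma rmean_normc_le (f : R[i] -> R[i]) (eta : R) : bmc f -> 0 <= eta ->
  rmean (fun z => normc (f z) ^+ 2) <= eta ^+ 2 ->
  rmean (fun z => normc (f z)) <= eta.
Proof.
move=> fb eta0 H; have r0 : 0 <= rmean (fun z => normc (f z)).
  by apply: rmean_ge0 => [|z _]; [exact: bmr_normc|exact: normc_ge0].
rewrite -(@ler_pXn2r _ 2) ?nnegrE//.
exact: le_trans (rmean_sqr_le (bmr_normc fb)) H.
Qed.

(** The defect [| |a|^2 + |b|^2 - 1 |] is at most [2 e + (1 + 1 / e) d] for every
    [e > 0], where [d] is the squared distance to a pair on the unit sphere. *)
Lemma unit_pair_ae (A B : nat -> R[i] -> R[i]) a b : (forall N, bmc (A N)) ->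
  (forall N, bmc (B N)) -> circ_measurable a -> circ_measurable b ->
  (forall N z, normc z = 1 -> normc (A N z) ^+ 2 + normc (B N z) ^+ 2 = 1) ->
  L2_cvg A a -> L2_cvg B b ->
  ae_circ (fun z => normc (a z) ^+ 2 + normc (b z) ^+ 2 = 1).
Proof.
move=> Ab Bb ma mb AB Aa Bb_.
pose h z := `|normc (a z) ^+ 2 + normc (b z) ^+ 2 - 1|.
have mh : rmeas h.
  apply: rmeas_comp; first exact: normr_measurable.
  by apply: rmeasB (rmeas_cst 1); apply: rmeasD; exact: rmeas_normc2.
suff : ae_circ (fun z => h z = 0).
  by apply: ae_circS => z _ /eqP; rewrite normr_eq0 subr_eq0 => /eqP.
apply: (emean_eq0 mh) => [z _|eta eta0]; first exact: normr_ge0.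
pose e : R := eta / 4; have e0 : 0 < e by rewrite divr_gt0.
pose d : R := e / (1 + e^-1); have e1 : 0 < 1 + e^-1 by rewrite addr_gt0 ?invr_gt0.
have d0 : 0 < d by rewrite divr_gt0.
have [N1 H1] := L2_cvg_small Aa d0; have [N2 H2] := L2_cvg_small Bb_ d0.
pose N := maxn N1 N2.
pose D z := normc (A N z - a z) ^+ 2 + normc (B N z - b z) ^+ 2.
have m1 : rmeas (fun z => normc (A N z - a z) ^+ 2).
  by apply: rmeas_normc2; apply: circ_measB => //; exact: bmc_meas.
have m2 : rmeas (fun z => normc (B N z - b z) ^+ 2).
  by apply: rmeas_normc2; apply: circ_measB => //; exact: bmc_meas.
have mD : rmeas D by exact: rmeasD.
apply: (@le_trans _ _ (emean (fun z => 2 * e + (1 + e^-1) * D z)%R)).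
  apply: le_emean => //.
    by apply: rmeasD (rmeas_cst _) _; apply: rmeasM (rmeas_cst _) _.
  move=> z z1; rewrite normr_ge0 /=.
  have key (x y : R[i]) : normc x <= 1 ->
      `|normc y ^+ 2 - normc x ^+ 2| <= e + (1 + e^-1) * normc (x - y) ^+ 2.
    move=> x1; set c := normc (x - y).
    have c0 : 0 <= c by exact: normc_ge0.
    have yx : `|normc y - normc x| <= c by rewrite distrC normc_sub_ge.
    rewrite subr_sqr normrM; apply: (@le_trans _ _ (c * (c + 2))).
      apply: ler_pM => //; rewrite ger0_norm ?addr_ge0 ?normc_ge0//.
      by move: yx; rewrite ler_norml => /andP[_ ?]; lra.
    (* 2 c is absorbed by e + c ^ 2 / e *)
    have -> : e + (1 + e^-1) * c ^+ 2 = c * (c + 2) + e^-1 * (c - e) ^+ 2.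
      by field; rewrite gt_eqF.
    by rewrite lerDl mulr_ge0 ?sqr_ge0// invr_ge0 ltW.
  have ab1 := AB N z z1.
  have a1 : normc (A N z) <= 1.
    by rewrite -(@expr_le1 _ 2) ?normc_ge0// -ab1 lerDl sqr_ge0.
  have b1 : normc (B N z) <= 1.
    by rewrite -(@expr_le1 _ 2) ?normc_ge0// -ab1 lerDr sqr_ge0.
  have := key _ (a z) a1; have := key _ (b z) b1.
  rewrite /h -{3}ab1 => k1 k2.
  apply: (@le_trans _ _ (`|normc (a z) ^+ 2 - normc (A N z) ^+ 2| +
     `|normc (b z) ^+ 2 - normc (B N z) ^+ 2|)).
    apply: le_trans (ler_normD _ _); rewrite le_eqVlt; apply/orP; left; apply/eqP.
    by congr (`| _ |); ring.
  by rewrite /D mulrDr; lra.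
rewrite emean_affine; last 4 first.
- by rewrite mulr_ge0// ltW.
- exact: ltW.
- exact: mD.
- by move=> z _; rewrite addr_ge0 ?sqr_ge0.
rewrite emeanD//; last 2 first.
- by move=> z _; rewrite sqr_ge0.
- by move=> z _; rewrite sqr_ge0.
have D1 := H1 N (leq_maxl _ _); have D2 := H2 N (leq_maxr _ _).
apply: (@le_trans _ _ ((2 * e)%:E + (1 + e^-1)%:E * (d%:E + d%:E))%E).
  by rewrite leeD2l// lee_wpmul2l ?lee_fin ?(ltW e1)// leeD.
rewrite -(EFinD d d) -EFinM -EFinD lee_fin.
have dE : d * (1 + e^-1) = e by rewrite divfK// gt_eqF.
have -> : (1 + e^-1) * (d + d) = 2 * (d * (1 + e^-1)) by ring.
rewrite dE.
by rewrite /e; lra.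
Qed.

End NullSets.

(** * Approximation by partial Fourier sums *)

Section BestApproximation.
Variable R : realType.
Implicit Types (z u v : R[i]) (f g : R[i] -> R[i]) (w : int -> R) (P : pred int).

Lemma normc2D z u : normc (z + u) ^+ 2 =
  normc z ^+ 2 + normc u ^+ 2 + 2 * complex.Re (z * conjc u).
Proof. by rewrite !normc_sqr; case: z => x y; case: u => p q /=; ring. Qed.

Lemma circ_int_mul_conj f g P : bmc f -> tpoly P g ->
  (forall k, P k -> fourier f k = 0) ->
  circ_int (fun z => f z * conjc (g z)) = 0.
Proof.
move=> fb gt f0; have [r [_ rP gr]] := tpoly_expand gt.
rewrite (@circ_int_ext _ _
  (fun z => \sum_(k <- r) conjc (fourier g k) * (f z * z ^ (- k)))); last first.
  move=> z z1; rewrite gr// rmorph_sum mulr_sumr; apply: eq_bigr => k _.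
  by rewrite rmorphM/= unit_conj_exprz// mulrCA.
have Fb k : bmc (fun z => f z * z ^ (- k)) by exact: fourier_bmc.
rewrite circ_int_sum; last by move=> k; exact: bmcZ.
rewrite big_seq big1// => k kr; rewrite circ_intZ//.
by rewrite -[circ_int _]/(fourier f k) f0 ?mulr0//; exact: rP.
Qed.

(** Take for [p] the partial sum of the Fourier series of [b] over the
    frequencies of [q]: then [b - p] is orthogonal to [p - q], and Pythagoras
    applies. *)
Lemma fourier_best_approx w (beta : R) b q P : even_weight w -> bmc b -> tpoly P q ->
  (forall r : seq int, uniq r -> \sum_(k <- r) normc (fourier b k) * w k <= beta) ->
  exists2 p, wpoly w beta xpredT p &
    rmean (fun z => normc (b z - p z) ^+ 2) <= rmean (fun z => normc (b z - q z) ^+ 2).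
Proof.
move=> ww bb qt bw; have [r [ur rP qr]] := tpoly_expand qt.
pose s := [seq (fourier b k, k) | k <- r].
have pE z : trig s z = \sum_(k <- r) fourier b k * z ^ k by rewrite /trig big_map.
have pw : wpoly w beta xpredT (trig s).
  exists s; split=> //; first exact/allP.
  by rewrite /trig_norm big_map; exact: bw.
exists (trig s) => //.
have pb : bmc (trig s) by exact: bmc_trig.
have qb : bmc q by exact: bmc_tpoly qt.
have bpb : bmc (fun z => b z - trig s z) by exact: bmcB.
have pqb : bmc (fun z => trig s z - q z) by exact: bmcB.
have pqt : tpoly (mem r) (fun z => trig s z - q z).
  apply: (@tpoly_weak _ (mem r) _
    (fun z => \sum_(k <- r) (fourier b k - fourier q k) * z ^ k)) => //.
    exists (trig_norm (fun=> 1) [seq (fourier b k - fourier q k, k) | k <- r]).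
    exists [seq (fourier b k - fourier q k, k) | k <- r]; split=> //.
      by rewrite all_map; apply/allP.
    by move=> z _; rewrite /trig big_map.
  move=> z z1; rewrite pE qr// -sumrB; apply: eq_bigr => k _; by rewrite mulrBl.
have orth : circ_int (fun z => (b z - trig s z) * conjc (trig s z - q z)) = 0.
  apply: circ_int_mul_conj bpb pqt _ => k kr.
  rewrite fourierB// fourier_trig big_map /=.
  have -> : \sum_(j <- r | j == k) fourier b j = fourier b k.
    by rewrite big_mkcond (bigD1_seq k)//= eqxx big1 ?addr0// => j /negbTE ->.
  by rewrite subrr.
have t1 : bmr (fun z => normc (b z - trig s z) ^+ 2) by exact: bmr_normc2.
have t2 : bmr (fun z => normc (trig s z - q z) ^+ 2) by exact: bmr_normc2.
have t3 : bmr (fun z => complex.Re ((b z - trig s z) * conjc (trig s z - q z))).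
  by apply: bmr_Re; apply: bmcM => //; exact: bmc_conj.
rewrite (@rmean_ext _ (fun z => normc (b z - q z) ^+ 2) (fun z =>
  (normc (b z - trig s z) ^+ 2 + normc (trig s z - q z) ^+ 2) +
  2 * complex.Re ((b z - trig s z) * conjc (trig s z - q z)))); last first.
  by move=> z _; rewrite -normc2D subrKA.
rewrite rmeanD; [|exact: bmrD|exact: bmrZ].
rewrite rmeanD// rmeanZ//.
have -> : rmean (fun z => complex.Re ((b z - trig s z) * conjc (trig s z - q z))) = 0.
  by move: orth; rewrite circ_intE => /(congr1 (@complex.Re R)).
rewrite mulr0 addr0 lerDl; apply: rmean_ge0 => // z _; exact: sqr_ge0.
Qed.

(** The partial sums approximate [b] at least as well as the given polynomials,
    and the norm of the coefficients of [b] bounds theirs. *)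
Lemma fourier_approx w (beta : R) b (B : nat -> R[i] -> R[i]) (P : nat -> pred int) :
  even_weight w -> bmc b -> (forall N, tpoly (P N) (B N)) ->
  (forall r : seq int, uniq r -> \sum_(k <- r) normc (fourier b k) * w k <= beta) ->
  (forall eta, 0 < eta -> exists N0 : nat, forall N, (N0 <= N)%N ->
    rmean (fun z => normc (B N z - b z) ^+ 2) <= eta) ->
  forall eta, 0 < eta -> exists2 p, wpoly w beta xpredT p &
     rmean (fun z => normc (b z - p z)) <= eta.
Proof.
move=> ww bb Bt bw Bb eta eta0.
have [N HN] := Bb _ (exprn_gt0 2 eta0); have {}HN := HN N (leqnn N).
have [p pw pq] := fourier_best_approx ww bb (Bt N) bw.
exists p => //; apply: rmean_normc_le; last 2 first.
- exact: ltW.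
- apply: le_trans pq _; rewrite (@rmean_ext _ _ (fun z => normc (B N z - b z) ^+ 2))//.
  by move=> z _; rewrite normcB.
by apply: bmcB bb _; exact: bmc_tpoly (wpoly_tpoly ww pw).
Qed.

(** Polynomials of norm at most [beta] are bounded by [beta], so the mean of the
    excess of [|b|] over [beta] is at most the [L^1] distance to any of them. *)
Lemma normc_bound_ae w (beta : R) b : even_weight w -> bmc b ->
  (forall eta, 0 < eta -> exists2 p, wpoly w beta xpredT p &
     rmean (fun z => normc (b z - p z)) <= eta) ->
  ae_circ (fun z => normc (b z) <= beta).
Proof.
move=> ww bb bapp; pose h z := Num.max (normc (b z) - beta) 0.
have hb : bmr h.
  have maxE (x : R) : Num.max x 0 = 2^-1 * (x + `|x|).
    by case: (lerP 0 x) => x0; [rewrite ger0_norm//|rewrite ltr0_norm//]; lra.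
  have db : bmr (fun z => normc (b z) - beta).
    by apply: bmrB (bmr_cst _); exact: bmr_normc.
  by apply: bmr_ext (bmrZ 2^-1 (bmrD db (bmr_norm db))) _ => z _; rewrite -maxE.
suff : ae_circ (fun z => h z = 0).
  apply: ae_circS => z _ hz; rewrite -subr_le0 -hz /h.
  by rewrite le_max lexx.
apply: emean_eq0; first exact: rmeas_bmr.
  by move=> z _; rewrite /h le_max lexx orbT.
move=> eta eta0; have [p pw bp] := bapp _ eta0.
rewrite emean_bmr// lee_fin; apply: le_trans bp; apply: le_rmean => //.
  by apply: bmr_normc; apply: bmcB bb _; exact: bmc_tpoly (wpoly_tpoly ww pw).
move=> z z1; rewrite /h ge_max normc_ge0 andbT.
have := wpoly_bound ww pw z1; have := normc_sub_ge (b z) (p z).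
by rewrite ler_norml => /andP[_]; lra.
Qed.

End BestApproximation.

(** * Products of nonlinear Fourier factors *)

Section FactorProducts.
Variable R : realType.
Variable F : int -> R[i].
Implicit Types (z u v : R[i]) (m n k : int) (r : nat).

Let s m : R := (Num.sqrt (1 + normc (F m) ^+ 2))^-1.

(** The first row of the product of the factors with indices from [m] to
    [m + r - 1]; on the circle, it determines the second row.  Splitting off the
    leftmost factor keeps the frequencies of the remaining product above [m]. *)
Fixpoint su2_row m r z : R[i] * R[i] :=
  if r is r'.+1 then
    let: (a, b) := su2_row (m + 1) r' z in
    (real_complex R (s m) * (a - F m * z ^ m * conjc b),
     real_complex R (s m) * (b + F m * z ^ m * conjc a))
  else (1, 0).

Let ra m r z := (su2_row m r z).1.
Let rb m r z := (su2_row m r z).2.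

Lemma su2_row1S m r z : ra m r.+1 z =
  real_complex R (s m) * (ra (m + 1) r z - F m * z ^ m * conjc (rb (m + 1) r z)).
Proof. by rewrite /ra /rb /=; case: (su2_row _ _ _). Qed.

Lemma su2_row2S m r z : rb m r.+1 z =
  real_complex R (s m) * (rb (m + 1) r z + F m * z ^ m * conjc (ra (m + 1) r z)).
Proof. by rewrite /ra /rb /=; case: (su2_row _ _ _). Qed.

Lemma su2_row_matrix m r z : normc z = 1 ->
  \prod_(j < r) nlft_factor F (m + j%:Z) z =
  mx2 (ra m r z) (rb m r z) (- conjc (rb m r z)) (conjc (ra m r z)).
Proof.
move=> z1; elim: r m => [|r IH] m.
  rewrite big_ord0 -[ra m 0 z]/1 -[rb m 0 z]/0 conjc0 conjc1 oppr0.
  by apply/matrixP => i j; rewrite !mxE; case: i => -[|[|]]//= ?; case: j => -[|[|]].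
rewrite big_ord_recl addr0 (eq_bigr (fun j : 'I_r => nlft_factor F (m + 1 + j%:Z) z)).
  rewrite IH su2_row1S su2_row2S /nlft_factor -/(s m).
  set a := ra (m + 1) r z; set b := rb (m + 1) r z.
  set S := real_complex R (s m); have cS : conjc S = S by exact: conjc_real.
  rewrite !(conjcM, conjcD, conjcN) !conjcK !unit_conj_exprz// cS.
  apply/matrixP => i j; rewrite !mxE !big_ord_recl big_ord0 !mxE.
  by case: i => -[|[|]]//= ?; case: j => -[|[|]]//= ?; ring.
by move=> j _; congr (nlft_factor F _ z); rewrite /= -addrA; congr (_ + _); lia.
Qed.

Lemma nlft_trunc_row N z : normc z = 1 ->
  nlft_trunc F N z 0 0 = ra (- N%:Z) (2 * N).+1 z /\
  nlft_trunc F N z 0 1 = rb (- N%:Z) (2 * N).+1 z.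
Proof.
move=> z1; rewrite /nlft_trunc.
rewrite (eq_bigr (fun j : 'I_(2 * N).+1 => nlft_factor F (- N%:Z + j%:Z) z)).
  by rewrite su2_row_matrix// !mxE.
by move=> j _; rewrite addrC.
Qed.

Lemma su2_row_unit m r z : normc z = 1 ->
  ra m r z * conjc (ra m r z) + rb m r z * conjc (rb m r z) = 1.
Proof.
move=> z1; elim: r m => [|r IH] m.
  by rewrite -[ra m 0 z]/1 -[rb m 0 z]/0 conjc1 mulr1 mul0r addr0.
rewrite su2_row1S su2_row2S; have := IH (m + 1).
set a := ra _ _ _; set b := rb _ _ _ => E.
set S := real_complex R (s m); have cS : conjc S = S by exact: conjc_real.
rewrite !(conjcM, conjcD, conjcN) !conjcK !unit_conj_exprz// cS.
have zz : z ^ m * z ^ (- m) = 1 by rewrite -unit_exprzD// subrr expr0z.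
have SS : S * S * (1 + F m * conjc (F m)) = 1.
  rewrite mul_conjc /S -(rmorph1 (real_complex R)) -rmorphD -!rmorphM; congr (real_complex R _).
  have p : 0 < 1 + normc (F m) ^+ 2 by rewrite ltr_pwDl// sqr_ge0.
  by rewrite /s -expr2 exprVn sqr_sqrtr ?ltW// mulVf// gt_eqF.
transitivity (S * S * (1 + F m * conjc (F m) * (z ^ m * z ^ (- m))) *
  (a * conjc a + b * conjc b)); first by ring.
by rewrite E zz !mulr1.
Qed.

Lemma su2_row_normc m r z : normc z = 1 ->
  normc (ra m r z) ^+ 2 + normc (rb m r z) ^+ 2 = 1.
Proof.
move=> z1; apply: (@complexI R); rewrite rmorphD rmorph1.
by have := su2_row_unit m r z1; rewrite !mul_conjc.
Qed.

Lemma su2_row_cat m r1 r2 z :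
  ra m (r1 + r2) z = ra m r1 z * ra (m + r1%:Z) r2 z -
    rb m r1 z * conjc (rb (m + r1%:Z) r2 z) /\
  rb m (r1 + r2) z = ra m r1 z * rb (m + r1%:Z) r2 z +
    rb m r1 z * conjc (ra (m + r1%:Z) r2 z).
Proof.
elim: r1 m => [|r IH] m.
  by rewrite add0n addr0 /ra /rb /= !mul1r !mul0r subr0 addr0.
rewrite addSn !su2_row1S !su2_row2S.
have -> : m + r.+1%:Z = m + 1 + r%:Z by rewrite -addrA; congr (_ + _); lia.
have [-> ->] := IH (m + 1).
by rewrite !(conjcM, conjcD, conjcN) !conjcK; split; ring.
Qed.

(** Right multiplication by the inverse of the right factor, which is its
    adjoint. *)
Lemma su2_row_cancel m r1 r2 z : normc z = 1 ->
  ra m r1 z = ra m (r1 + r2) z * conjc (ra (m + r1%:Z) r2 z) +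
              rb m (r1 + r2) z * conjc (rb (m + r1%:Z) r2 z) /\
  rb m r1 z = rb m (r1 + r2) z * ra (m + r1%:Z) r2 z -
              ra m (r1 + r2) z * rb (m + r1%:Z) r2 z.
Proof.
move=> z1; have [-> ->] := su2_row_cat m r1 r2 z.
have := su2_row_unit (m + r1%:Z) r2 z1.
set a := ra _ r2 z; set b := rb _ r2 z; set a' := ra m r1 z; set b' := rb m r1 z => E.
split.
  transitivity (a' * (a * conjc a + b * conjc b)); first by rewrite E mulr1.
  by ring.
transitivity (b' * (a * conjc a + b * conjc b)); first by rewrite E mulr1.
by ring.
Qed.

Lemma su2_row_tpoly m r :
  tpoly (fun k => - r%:Z <= k <= 0) (ra m r) /\
  tpoly (fun k => m <= k < m + r%:Z) (rb m r).
Proof.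
elim: r m => [|r IH] m.
  split.
    by apply: tpoly_weak (@tpoly_cst _ (fun k => - 0%:Z <= k <= 0) 1 _) _ _.
  exists 0, [::]; split=> // [|z _]; first by rewrite /trig_norm big_nil.
  by rewrite /rb /= /trig big_nil.
have [at_ bt] := IH (m + 1); split.
  have t2 : tpoly (fun k => - r.+1%:Z <= k <= 0)
      (fun z => F m * z ^ m * conjc (rb (m + 1) r z)).
    apply: (tpolyM (P1 := pred1 m) (P2 := fun k => - (m + r%:Z) <= k <= - (m + 1))).
    - by move=> i j /eqP ->; lia.
    - by apply: tpoly_monomial; rewrite /= eqxx.
    - by apply: tpoly_conj bt => k; lia.
  have t1 : tpoly (fun k => - r.+1%:Z <= k <= 0) (ra (m + 1) r).
    by apply: tpoly_weak at_ _ _ => // k; lia.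
  apply: tpoly_weak (tpolyZ (real_complex R (s m)) (tpolyB t1 t2)) _ _ => // z _.
  by rewrite su2_row1S.
have t2 : tpoly (fun k => m <= k < m + r.+1%:Z)
    (fun z => F m * z ^ m * conjc (ra (m + 1) r z)).
  apply: (tpolyM (P1 := pred1 m) (P2 := fun k => 0 <= k <= r%:Z)).
  - by move=> i j /eqP ->; lia.
  - by apply: tpoly_monomial; rewrite /= eqxx.
  - by apply: tpoly_conj at_ => k; lia.
have t1 : tpoly (fun k => m <= k < m + r.+1%:Z) (rb (m + 1) r).
  by apply: tpoly_weak bt _ _ => // k; lia.
apply: tpoly_weak (tpolyZ (real_complex R (s m)) (tpolyD t1 t2)) _ _ => // z _.
by rewrite su2_row2S.
Qed.

(** The constant coefficient of the diagonal entry. *)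
Fixpoint su2_mean m r : R := if r is r'.+1 then s m * su2_mean (m + 1) r' else 1.

Lemma s_bounds m : 0 < s m <= 1.
Proof.
have p : 1 <= Num.sqrt (1 + normc (F m) ^+ 2).
  by rewrite -{1}(@sqrtr1 R) ler_wsqrtr// lerDl sqr_ge0.
by rewrite /s invr_gt0 (lt_le_trans ltr01 p)/= invf_le1// (lt_le_trans ltr01 p).
Qed.

Lemma su2_mean_bounds m r : 0 < su2_mean m r <= 1.
Proof.
elim: r m => [|r IH] m /=; first by rewrite ltr01 lexx.
have /andP[s0 s1] := s_bounds m; have /andP[i0 i1] := IH (m + 1).
by rewrite mulr_gt0//= mulr_ile1// ltW.
Qed.

Lemma su2_mean_cat m r1 r2 :
  su2_mean m (r1 + r2) = su2_mean m r1 * su2_mean (m + r1%:Z) r2.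
Proof.
elim: r1 m => [|r IH] m /=; first by rewrite addr0 mul1r.
rewrite IH mulrA; congr (_ * su2_mean _ _).
by rewrite -addrA; congr (_ + _); lia.
Qed.

Lemma circ_int_su2_row m r : circ_int (ra m r) = real_complex R (su2_mean m r).
Proof.
elim: r m => [|r IH] m; first exact: (circ_int_cst 1).
have [at_ bt] := su2_row_tpoly (m + 1) r.
have ab : bmc (ra (m + 1) r) := bmc_tpoly at_.
have t2 : tpoly (fun k => k < 0) (fun z => F m * z ^ m * conjc (rb (m + 1) r z)).
  apply: (tpolyM (P1 := pred1 m) (P2 := fun k => k <= - (m + 1))).
  - by move=> i j /eqP ->; lia.
  - by apply: tpoly_monomial; rewrite /= eqxx.
  - by apply: tpoly_conj bt => k; lia.
have b2 := bmc_tpoly t2.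
rewrite (@circ_int_ext _ (ra m r.+1) (fun z => real_complex R (s m) *
  (ra (m + 1) r z - F m * z ^ m * conjc (rb (m + 1) r z)))); last first.
  by move=> z _; rewrite su2_row1S.
rewrite circ_intZ ?circ_intB//; last exact: bmcB.
by rewrite -[X in _ - X]fourier0 (tpoly_fourier_eq0 t2)// subr0 IH -rmorphM.
Qed.

(** The leftmost factor contributes [F m] times the conjugate of the remaining
    diagonal entry, and the rest has frequencies above [m]: this is how the
    sequence is read off from its transform. *)
Lemma fourier_su2_row m r :
  fourier (rb m r.+1) m = F m * real_complex R (su2_mean m r.+1).
Proof.
have [at_ bt] := su2_row_tpoly (m + 1) r.
have ab : bmc (ra (m + 1) r) := bmc_tpoly at_.
have bb : bmc (rb (m + 1) r) := bmc_tpoly bt.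
have acb : bmc (fun z => conjc (ra (m + 1) r z)) := bmc_conj ab.
have aczb : bmc (fun z => conjc (ra (m + 1) r z) * z ^ m).
  by apply: bmcM acb _; exact: bmc_exprz.
rewrite (@fourier_ext _ (rb m r.+1) (fun z => real_complex R (s m) *
  (rb (m + 1) r z + F m * (conjc (ra (m + 1) r z) * z ^ m)))); last first.
  by move=> z _; rewrite su2_row2S; congr (_ * (_ + _)); rewrite -mulrA [z ^ m * _]mulrC.
rewrite fourierZ; last by apply: bmcD => //; exact: bmcZ.
rewrite fourierD//; last exact: bmcZ.
rewrite (tpoly_fourier_eq0 bt); last by lia.
rewrite add0r fourierZ// fourierMexprz subrr fourier0 circ_int_conj// circ_int_su2_row.
by rewrite conjc_real /= mulrCA -rmorphM.
Qed.

End FactorProducts.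

(** * The Hankel majorant *)

Section Majorant.
Variable R : realType.
Implicit Types (h w : int -> R) (u v : int -> \bar R) (m : int).
Local Open Scope ereal_scope.

Lemma esum_mull_le (T : choiceType) (x : \bar R) (a : T -> \bar R) : 0 <= x ->
  (forall i, 0 <= a i) -> \esum_(i in [set: T]) (x * a i) <= x * \esum_(i in [set: T]) a i.
Proof.
move=> x0 a0; apply: ge_ereal_sup => _ [X [finX _] <-].
rewrite -ge0_mule_fsumr//; apply: lee_wpmul2l => //.
by apply: esum_ge; exists X.
Qed.

Lemma mul_esum_le (T : choiceType) (c : R) (a : T -> \bar R) : (0 < c)%R ->
  (forall i, 0 <= a i) ->
  (c%:E * (\esum_(i in [set: T]) a i) <= \esum_(i in [set: T]) (c%:E * a i))%E.
Proof.
move=> c0 a0.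
have ca0 i : 0 <= c%:E * a i by rewrite mule_ge0// lee_fin ltW.
have c1 : (c * c^-1 = 1)%R by rewrite divff// gt_eqF.
rewrite -[leRHS]mul1e -c1 EFinM -muleA; apply: lee_wpmul2l.
  by rewrite lee_fin ltW.
apply: le_trans (esum_mull_le _ ca0); last by rewrite lee_fin invr_ge0 ltW.
by apply: le_esum => i _; rewrite muleA -EFinM mulrC c1 mul1e.
Qed.

Lemma esum_swap (T T' : choiceType) (a : T -> T' -> \bar R) :
  (forall i j, 0 <= a i j) ->
  \esum_(i in [set: T]) \esum_(j in [set: T']) a i j =
  \esum_(j in [set: T']) \esum_(i in [set: T]) a i j.
Proof.
move=> a0; rewrite !esum_esum//.
rewrite (@reindex_esum _ _ _ [set: T' * T] _ (fun k => (k.2, k.1))); last first.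
  split=> [x _ //|[x1 x2] [y1 y2] _ _ [-> ->] //|[x y] _].
  by exists (y, x).
by congr esum; apply/seteqP; split.
Qed.

Lemma esum_shift (a : int -> \bar R) j :
  \esum_(m in [set: int]) a (m + j)%R = \esum_(m in [set: int]) a m.
Proof.
symmetry; apply: (@reindex_esum _ _ _ _ _ (fun m => m + j)%R).
split=> [x _ //|x y _ _ /addIr //|x _].
by exists (x - j)%R; rewrite // subrK.
Qed.

Lemma sum_seq_le_esum (T : choiceType) (r : seq T) (a : T -> \bar R) : uniq r ->
  (forall i, 0 <= a i) -> \sum_(i <- r) a i <= \esum_(i in [set: T]) a i.
Proof.
move=> ur a0; apply: esum_ge; exists [set` r] => //.
by rewrite fsbig_seq.
Qed.

(** Indices run over all integers, which only enlarges sums of nonnegative terms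
    and turns a Hankel matrix into convolution with [h] up to a reflection; an
    even weight does not see the reflection. *)
Definition hankel h u m : \bar R := \esum_(j in [set: int]) ((h (m + j))%:E * u j).

Lemma hankel_ge0 h u m : (forall k, 0 <= h k)%R -> (forall j, 0 <= u j) ->
  0 <= hankel h u m.
Proof. by move=> h0 u0; apply: esum_ge0 => j _; rewrite mule_ge0// lee_fin. Qed.

Lemma le_hankel h u v m : (forall k, 0 <= h k)%R -> (forall j, u j <= v j) ->
  hankel h u m <= hankel h v m.
Proof.
by move=> h0 uv; apply: le_esum => j _; apply: lee_wpmul2l => //; rewrite lee_fin.
Qed.

Lemma hankel_affine h u (Q c d : R) m : (forall k, 0 <= h k)%R ->
  \esum_(k in [set: int]) (h k)%:E <= Q%:E -> (0 <= c)%R -> (0 <= d)%R ->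
  (forall j, 0 <= u j) ->
  hankel h (fun j => c%:E * u j + d%:E) m <= c%:E * hankel h u m + (d * Q)%:E.
Proof.
move=> h0 hQ c0 d0 u0.
have hE k : 0 <= (h k)%:E by rewrite lee_fin.
have huE j : 0 <= (h (m + j))%:E * u j by rewrite mule_ge0.
rewrite /hankel (eq_esum (b := fun j => c%:E * ((h (m + j))%:E * u j) +
  d%:E * (h (m + j))%:E)); last first.
  move=> j _; rewrite ge0_muleDr ?mule_ge0 ?lee_fin//; congr (_ + _); first by rewrite muleCA.
  by rewrite muleC.
rewrite esumD; last 2 first.
- by move=> j _; rewrite mule_ge0// lee_fin.
- by move=> j _; rewrite mule_ge0// lee_fin.
apply: leeD; first by apply: esum_mull_le => //; rewrite lee_fin.
apply: le_trans (esum_mull_le _ _) _ => //.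
rewrite EFinM; apply: lee_wpmul2l; first by rewrite lee_fin.
apply: le_trans hQ; rewrite -(esum_shift _ m).
by apply: le_esum => j _; rewrite addrC.
Qed.

Definition wsum w u : \bar R := \esum_(m in [set: int]) ((w m)%:E * u m).

(** Young's inequality with weights: [w m <= w (m + j) * w j]. *)
Lemma wsum_hankel w h u (Q : R) : even_weight w -> (forall k, 0 <= h k)%R ->
  (0 <= Q)%R -> wsum w (EFin \o h) <= Q%:E -> (forall j, 0 <= u j) ->
  wsum w (hankel h u) <= Q%:E * wsum w u.
Proof.
move=> [w1 wN wD] h0 Q0 hQ u0.
have w0 k : (0 <= w k)%R by exact: le_trans (w1 k).
have hu0 m j : 0 <= (h (m + j))%:E * u j by rewrite mule_ge0// lee_fin.
have wu0 j : 0 <= (w j)%:E * u j by rewrite mule_ge0// lee_fin.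
have wh0 k : 0 <= (w k)%:E * (h k)%:E by rewrite mule_ge0// lee_fin.
apply: (@le_trans _ _ (\esum_(m in [set: int]) \esum_(j in [set: int])
    (((w j)%:E * u j) * ((w (m + j))%:E * (h (m + j))%:E)))).
  apply: le_esum => m _.
  apply: le_trans (mul_esum_le (lt_le_trans ltr01 (w1 m)) (hu0 m)) _.
  apply: le_esum => j _; rewrite [leRHS]muleACA [X in _ * X]muleC -EFinM.
  apply: lee_wpmul2r; first by rewrite muleC.
  rewrite lee_fin mulrC.
  have -> : (w m = w ((m + j) + - j))%R by rewrite addrK.
  by apply: le_trans (wD _ _) _; rewrite wN.
rewrite esum_swap; last by move=> m j; rewrite mule_ge0.
apply: (@le_trans _ _ (\esum_(j in [set: int]) (Q%:E * ((w j)%:E * u j)))).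
  apply: le_esum => j _; apply: le_trans (esum_mull_le _ _) _ => //.
  rewrite muleC; apply: lee_wpmul2r => //.
  by rewrite (esum_shift (fun m => (w m)%:E * (h m)%:E)).
by apply: esum_mull_le => //; rewrite lee_fin.
Qed.

(** Partial sums of the series of [S ^ (2 l) h] over [l], with [S] the Hankel
    operator of [h]; only even powers occur since the coefficients of [A] and [B]
    alternate. *)
Fixpoint majorant h K m : \bar R :=
  if K is K'.+1 then (h m)%:E + hankel h (hankel h (majorant h K')) m else 0.

Lemma majorant_ge0 h K m : (forall k, 0 <= h k)%R -> 0 <= majorant h K m.
Proof.
move=> h0; elim: K m => [|K IH] m //=.
by rewrite adde_ge0 ?lee_fin//; do 2 apply: hankel_ge0 => // ?.
Qed.

Lemma wsumD w u v : (forall m, 0 <= w m)%R -> (forall m, 0 <= u m) ->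
  (forall m, 0 <= v m) -> wsum w (fun m => u m + v m) = wsum w u + wsum w v.
Proof.
move=> w0 u0 v0; rewrite /wsum -esumD; last 2 first.
- by move=> m _; rewrite mule_ge0// lee_fin.
- by move=> m _; rewrite mule_ge0// lee_fin.
by apply: eq_esum => m _; rewrite ge0_muleDr.
Qed.

(** Each application of the Hankel operator costs a factor [Q], and the bound is
    the fixed point of [x = Q + Q ^ 2 x]. *)
Lemma wsum_majorant w h (Q : R) K : even_weight w -> (forall k, 0 <= h k)%R ->
  (0 <= Q < 1)%R -> wsum w (EFin \o h) <= Q%:E ->
  wsum w (majorant h K) <= (Q / (1 - Q ^+ 2))%:E.
Proof.
move=> ww h0 /andP[Q0 Q1] hQ; have Q2 : (0 < 1 - Q ^+ 2)%R by nra.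
have w0 k : (0 <= w k)%R by case: ww => w1 _ _; exact: le_trans (w1 k).
elim: K => [|K IH].
  rewrite /wsum esum1; first by rewrite lee_fin divr_ge0// ltW.
  by move=> m _; rewrite /= mule0.
have M0 j : 0 <= majorant h K j by exact: majorant_ge0.
have HM0 j : 0 <= hankel h (majorant h K) j by exact: hankel_ge0.
have HHM0 j : 0 <= hankel h (hankel h (majorant h K)) j by exact: hankel_ge0.
rewrite /= wsumD//.
have -> : (Q / (1 - Q ^+ 2) = Q + Q * (Q * (Q / (1 - Q ^+ 2))))%R.
  by field; rewrite gt_eqF.
rewrite EFinD; apply: leeD => //.
apply: le_trans (wsum_hankel ww h0 Q0 hQ HM0) _.
rewrite EFinM; apply: lee_wpmul2l; first by rewrite lee_fin.
apply: le_trans (wsum_hankel ww h0 Q0 hQ M0) _.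
by rewrite EFinM; apply: lee_wpmul2l; first by rewrite lee_fin.
Qed.

(** The iteration starts from the trivial bound [u <= 1], whose contribution
    decays like [Q ^ (2 K)], while the defects add up to a geometric series. *)
Lemma hankel_iterate h u v (Q c delta : R) K : (forall k, 0 <= h k)%R ->
  (0 <= Q < 1)%R -> \esum_(k in [set: int]) (h k)%:E <= Q%:E ->
  (0 <= c)%R -> (0 <= delta)%R -> (forall m, 0 <= u m <= 1) -> (forall m, 0 <= v m) ->
  (forall m, u m <= (c * h m + delta)%:E + hankel h v m) ->
  (forall j, v j <= delta%:E + hankel h u j) ->
  forall m, u m <= c%:E * majorant h K m + (Q ^+ (2 * K) + 2 * delta / (1 - Q ^+ 2))%:E.
Proof.
move=> h0 /andP[Q0 Q1] hQ c0 d0 u01 v0 uv vu.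
have u0 m : 0 <= u m by case/andP: (u01 m).
have Q2 : (0 < 1 - Q ^+ 2)%R by nra.
elim: K => [|K IH] m.
  rewrite /= mule0 add0e muln0 expr0; case/andP: (u01 m) => _ /le_trans; apply.
  by rewrite lee_fin lerDl divr_ge0 ?mulr_ge0// ltW.
set rho := (_ + _)%R in IH; have rho0 : (0 <= rho)%R.
  by rewrite addr_ge0 ?exprn_ge0// divr_ge0 ?mulr_ge0// ltW.
have M0 j : 0 <= majorant h K j by exact: majorant_ge0.
have HM0 j : 0 <= hankel h (majorant h K) j by exact: hankel_ge0.
have HHM0 j : 0 <= hankel h (hankel h (majorant h K)) j by exact: hankel_ge0.
have v_le j : v j <= c%:E * hankel h (majorant h K) j + (rho * Q + delta)%:E.
  apply: le_trans (vu j) _; rewrite addeC EFinD addeA; apply: leeD => //.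
  apply: le_trans (le_hankel _ h0 IH) _.
  exact: hankel_affine.
apply: le_trans (uv m) _.
apply: (@le_trans _ _ ((c * h m + delta)%:E +
  (c%:E * hankel h (hankel h (majorant h K)) m + ((rho * Q + delta) * Q)%:E))).
  apply: leeD => //; apply: le_trans (le_hankel _ h0 v_le) _.
  apply: hankel_affine => //; by rewrite addr_ge0 ?mulr_ge0.
rewrite /= ge0_muleDr ?lee_fin// -EFinM EFinD -!addeA; apply: leeD => //.
rewrite addeCA; apply: leeD => //; rewrite -EFinD lee_fin.
have -> : (2 * K.+1 = 2 + 2 * K)%N by rewrite mulnS.
rewrite exprD /rho; set q := (Q ^+ (2 * K))%R.
set D := (2 * delta / (1 - Q ^+ 2))%R.
have DE : (D = 2 * delta + Q ^+ 2 * D)%R by rewrite /D; field; rewrite gt_eqF.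
have dQ : (delta * Q <= delta)%R by rewrite ler_piMr// ltW.
have -> : (delta + ((q + D) * Q + delta) * Q = delta + delta * Q + Q ^+ 2 * q + Q ^+ 2 * D)%R.
  by ring.
by lra.
Qed.

End Majorant.

(** * Hankel inequalities for the truncated transform *)

Section HankelInequalities.
Variable R : realType.
Implicit Types (z u v : R[i]) (f g : R[i] -> R[i]) (m n k : int) (P : pred int).

Lemma rmean_mul_le f g (eta : R) : bmc f -> bmc g ->
  (forall z, normc z = 1 -> normc (g z) <= 1) ->
  rmean (fun z => normc (f z)) <= eta -> rmean (fun z => normc (f z * g z)) <= eta.
Proof.
move=> fb gb g1; apply: le_trans; apply: le_rmean.
- by apply: bmr_normc; exact: bmcM.
- exact: bmr_normc.
- by move=> z z1; rewrite normcM ler_piMr ?normc_ge0// g1.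
Qed.

Lemma rmean_normcD f g (d e : R) : bmc f -> bmc g ->
  rmean (fun z => normc (f z)) <= d -> rmean (fun z => normc (g z)) <= e ->
  rmean (fun z => normc (f z + g z)) <= d + e.
Proof.
move=> fb gb fd ge; apply: le_trans (lerD fd ge).
rewrite -rmeanD; [|exact: bmr_normc|exact: bmr_normc].
apply: le_rmean; [by apply: bmr_normc; exact: bmcD|by apply: bmrD; exact: bmr_normc|].
by move=> z _; exact: le_normcD.
Qed.

(** A coefficient outside of the frequencies of [T] only sees the error [E]. *)
Lemma fourier_small P f T E (gamma : R[i]) (delta : R) m : normc gamma = 1 ->
  bmc f -> tpoly P T -> bmc E -> ~~ P m ->
  (forall z, normc z = 1 -> gamma * f z = T z + E z) ->
  rmean (fun z => normc (E z)) <= delta -> normc (fourier f m) <= delta.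
Proof.
move=> g1 fb Tt Eb Pm fTE Ed.
rewrite -[leLHS]mul1r -g1 -normcM -fourierZ// (fourier_ext _ fTE).
rewrite fourierD//; last exact: bmc_tpoly Tt.
rewrite (tpoly_fourier_eq0 Tt Pm) add0r.
exact: le_trans (normc_fourier_le _ Eb) Ed.
Qed.

Lemma fourier_mul_tpoly_le P f g m : bmc f -> tpoly P g -> exists r : seq int,
  [/\ uniq r, {subset r <= P} &
   normc (fourier (fun z => f z * g z) m) <=
     \sum_(k <- r) normc (fourier f (m - k)) * normc (fourier g k)].
Proof.
move=> fb gt; have [r [ur rP gr]] := tpoly_expand gt; exists r; split=> //.
rewrite (@fourier_ext _ _ (fun z => \sum_(k <- r) fourier g k * (f z * z ^ k))).
  have Fb k : bmc (fun z => f z * z ^ k) by apply: bmcM fb _; exact: bmc_exprz.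
  rewrite fourier_sum; last by move=> k; exact: bmcZ.
  apply: le_trans (normc_sum _ _) _; apply: ler_sum => k _.
  by rewrite fourierZ// fourierMexprz normcM mulrC.
by move=> z z1; rewrite gr// mulr_sumr; apply: eq_bigr => k _; rewrite mulrCA.
Qed.

(** The left factor of the truncated transform, cut at [n], is eliminated:
    multiplied by [conj g], which is up to a unimodular constant an approximate
    inverse of [a], its entries have no frequencies above [0] and [n - 1], which
    leaves two relations for the right factor [(A, B)]. *)
Lemma truncated_relations (F : int -> R[i]) a b c g (gamma : R[i]) (G eta : R) n r1 r2 :
  let aN := fun z => (su2_row F (n - r1%:Z) (r1 + r2) z).1 in
  let bN := fun z => (su2_row F (n - r1%:Z) (r1 + r2) z).2 in
  let A := fun z => (su2_row F n r2 z).1 in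
  let B := fun z => (su2_row F n r2 z).2 in
  bmc a -> bmc b -> bmc c ->
  (forall z, normc z = 1 -> c z * a z = b z) ->
  (forall z, normc z = 1 -> normc (c z) <= 1) ->
  normc gamma = 1 -> tpoly (fun k => 0 <= k) g -> 0 <= G ->
  (forall z, normc z = 1 -> normc (g z) <= G) ->
  rmean (fun z => normc (conjc (a z) * g z - gamma)) <= eta ->
  rmean (fun z => normc (aN z - a z)) <= eta ->
  rmean (fun z => normc (bN z - b z)) <= eta ->
  (forall m, n <= m ->
     normc (fourier (fun z => c z * A z - B z) m) <= 2 * (1 + G) * eta) /\
  (forall m, 1 <= m ->
     normc (fourier (fun z => conjc (A z) + c z * conjc (B z)) m) <= 2 * (1 + G) * eta).
Proof.
move=> aN bN A B ab bb cb ca c1 g1 gt G0 gG ga aNa bNb.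
pose am := fun z => (su2_row F (n - r1%:Z) r1 z).1.
pose bm := fun z => (su2_row F (n - r1%:Z) r1 z).2.
have [amt bmt] : tpoly (fun k => - r1%:Z <= k <= 0) am /\
    tpoly (fun k => n - r1%:Z <= k < n - r1%:Z + r1%:Z) bm := su2_row_tpoly F _ r1.
have [At Bt] : tpoly (fun k => - r2%:Z <= k <= 0) A /\
    tpoly (fun k => n <= k < n + r2%:Z) B := su2_row_tpoly F n r2.
have [aNt bNt] : tpoly _ aN /\ tpoly _ bN := su2_row_tpoly F (n - r1%:Z) (r1 + r2).
have gct : tpoly (fun k => k <= 0) (fun z => conjc (g z)).
  by apply: tpoly_conj gt => k; rewrite oppr_le0.
have gb := bmc_tpoly gt; have gcb := bmc_tpoly gct.
have Ab := bmc_tpoly At; have Bb := bmc_tpoly Bt.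
have aNb := bmc_tpoly aNt; have bNb' := bmc_tpoly bNt.
have rel z : normc z = 1 -> am z = aN z * conjc (A z) + bN z * conjc (B z) /\
    bm z = bN z * A z - aN z * B z.
  by move=> z1; have := su2_row_cancel F (n - r1%:Z) r1 r2 z1; rewrite subrK.
have unitAB z : normc z = 1 -> normc (A z) <= 1 /\ normc (B z) <= 1.
  move=> z1; have E : normc (A z) ^+ 2 + normc (B z) ^+ 2 = 1 := su2_row_normc F n r2 z1.
  by split; rewrite -(@expr_le1 _ 2) ?normc_ge0// -E ?lerDl ?lerDr sqr_ge0.
pose Ea z := conjc gamma - conjc (g z) * aN z.
pose Eb z := conjc gamma * c z - conjc (g z) * bN z.
have cgb : bmc (fun=> conjc gamma) := bmc_cst _.
have Eab : bmc Ea by apply: bmcB cgb _; exact: bmcM.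
have Ebb : bmc Eb by apply: bmcB; exact: bmcM.
have agb : bmc (fun z => conjc (a z) * g z - gamma).
  by apply: bmcB (bmc_cst _); apply: bmcM gb; exact: bmc_conj.
have daN : bmr (fun z => normc (aN z - a z)) by apply: bmr_normc; exact: bmcB.
have dbN : bmr (fun z => normc (bN z - b z)) by apply: bmr_normc; exact: bmcB.
have err (E : R[i] -> R[i]) (d : R[i] -> R) : bmc E -> bmr d -> rmean d <= eta ->
    (forall z, normc z = 1 -> normc (E z) <= normc (conjc (a z) * g z - gamma) + G * d z) ->
    rmean (fun z => normc (E z)) <= (1 + G) * eta.
  move=> Eb0 db0 de H.
  have db : bmr (fun z => G * d z) by exact: bmrZ.
  apply: le_trans (_ : _ <= rmean (fun z => normc (conjc (a z) * g z - gamma) + G * d z)) _.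
    apply: le_rmean => //; first exact: bmr_normc.
    by apply: bmrD => //; exact: bmr_normc.
  rewrite rmeanD//; last exact: bmr_normc.
  by rewrite rmeanZ// mulrDl mul1r lerD// ler_wpM2l.
have base z : normc (conjc gamma - conjc (g z) * a z) = normc (conjc (a z) * g z - gamma).
  by rewrite -normc_conj conjcD conjcN conjcM !conjcK normcB mulrC.
have Ea_le : rmean (fun z => normc (Ea z)) <= (1 + G) * eta.
  apply: (err _ (fun z => normc (aN z - a z))) => // z z1.
  have -> : Ea z = (conjc gamma - conjc (g z) * a z) + - (conjc (g z) * (aN z - a z)).
    by rewrite /Ea; ring.
  apply: le_trans (le_normcD _ _) _; rewrite base lerD2l normcN normcM normc_conj.
  by rewrite ler_wpM2r ?normc_ge0// gG.
have Eb_le : rmean (fun z => normc (Eb z)) <= (1 + G) * eta.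
  apply: (err _ (fun z => normc (bN z - b z))) => // z z1.
  have -> : Eb z = c z * (conjc gamma - conjc (g z) * a z) + - (conjc (g z) * (bN z - b z)).
    by rewrite /Eb -ca//; ring.
  apply: le_trans (le_normcD _ _) _; rewrite normcN !normcM normc_conj base.
  apply: lerD; first by rewrite ler_piMl ?normc_ge0// c1.
  by rewrite ler_wpM2r ?normc_ge0// gG.
have two : (1 + G) * eta + (1 + G) * eta = 2 * (1 + G) * eta by ring.
have Acb := bmc_conj Ab; have Bcb := bmc_conj Bb.
have cg1 : normc (conjc gamma) = 1 by rewrite normc_conj.
split=> m nm.
- apply: (@fourier_small (fun k => k < n) _ (fun z => conjc (g z) * bm z)
    (fun z => Eb z * A z + Ea z * - B z) (conjc gamma)) => //.
  + by apply: bmcB => //; exact: bmcM.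
  + by apply: tpolyM gct bmt => i j; lia.
  + apply: bmcD; apply: bmcM => //.
    by apply: bmc_ext (bmcZ (-1) Bb) _ => z _; rewrite mulN1r.
  + by rewrite -leNgt.
  + by move=> z z1; have [_ ->] := rel z z1; rewrite /Ea /Eb; ring.
  + have BNb : bmc (fun z => - B z).
      by apply: bmc_ext (bmcZ (-1) Bb) _ => z _; rewrite mulN1r.
    rewrite -two; apply: rmean_normcD; try exact: bmcM.
      by apply: rmean_mul_le => // z /unitAB[].
    by apply: rmean_mul_le => // z /unitAB[]; rewrite normcN.
- apply: (@fourier_small (fun k => k <= 0) _ (fun z => conjc (g z) * am z)
    (fun z => Ea z * conjc (A z) + Eb z * conjc (B z)) (conjc gamma)) => //.
  + by apply: bmcD => //; exact: bmcM.
  + by apply: tpolyM gct amt => i j; lia.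
  + by apply: bmcD; exact: bmcM.
  + by rewrite -ltNge; lia.
  + by move=> z z1; have [-> _] := rel z z1; rewrite /Ea /Eb; ring.
  + rewrite -two; apply: rmean_normcD; try exact: bmcM.
      by apply: rmean_mul_le => // z /unitAB[]; rewrite normc_conj.
    by apply: rmean_mul_le => // z /unitAB[]; rewrite normc_conj.
Qed.

(** The only source term in the two relations is the constant coefficient [c0]
    of [A] times [h], and [c0 * F n] is a coefficient of [B]: apart from the
    errors, both sides carry the factor [c0]. *)
Lemma truncated_bound (F : int -> R[i]) c (Q delta : R) n r K :
  let A := fun z => (su2_row F n r.+1 z).1 in
  let B := fun z => (su2_row F n r.+1 z).2 in
  let h := fun k => normc (fourier c k) in
  let c0 := su2_mean F n r.+1 in
  bmc c -> 0 <= Q < 1 -> 0 <= delta ->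
  (\esum_(k in [set: int]) (h k)%:E <= Q%:E)%E ->
  (forall m, n <= m -> normc (fourier (fun z => c z * A z - B z) m) <= delta) ->
  (forall m, 1 <= m ->
     normc (fourier (fun z => conjc (A z) + c z * conjc (B z)) m) <= delta) ->
  ((c0 * normc (F n))%:E <=
     c0%:E * majorant h K n + (Q ^+ (2 * K) + 2 * delta / (1 - Q ^+ 2))%:E)%E.
Proof.
move=> A B h c0 cb Q01 d0 hQ relB relA.
have [At Bt] : tpoly (fun k => - r.+1%:Z <= k <= 0) A /\
    tpoly (fun k => n <= k < n + r.+1%:Z) B := su2_row_tpoly F n r.+1.
have Ab := bmc_tpoly At; have Bb := bmc_tpoly Bt.
have Acb := bmc_conj Ab; have Bcb := bmc_conj Bb.
have h0 k : 0 <= h k by exact: normc_ge0.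
have /andP[c0_gt0 _] := su2_mean_bounds F n r.+1; rewrite -/c0 in c0_gt0.
have A0 : normc (fourier A 0) = c0.
  by rewrite fourier0 circ_int_su2_row normc_real ger0_norm// ltW.
pose u m := (normc (fourier B m))%:E.
(* the relation for the coefficients of A fails at 0, which is kept apart *)
pose v j := if 1 <= j then (normc (fourier A (- j)))%:E else 0%E.
have -> : (c0 * normc (F n))%:E = u n.
  rewrite /u /B fourier_su2_row normcM normc_real ger0_norm ?(ltW c0_gt0)//.
  by rewrite mulrC.
have u0 m : (0 <= u m)%E by rewrite lee_fin normc_ge0.
have v0 j : (0 <= v j)%E by rewrite /v; case: ifP => // _; rewrite lee_fin normc_ge0.
apply: (hankel_iterate (v := v)) => //; first exact: ltW.
- move=> m; rewrite u0 /= lee_fin; apply: le_trans (normc_fourier_le _ Bb) _.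
  rewrite -[leRHS](rmean_cst 1); apply: le_rmean; [exact: bmr_normc|exact: bmr_cst|].
  move=> z z1; rewrite -(@expr_le1 _ 2) ?normc_ge0//.
  by rewrite -(su2_row_normc F n r.+1 z1) lerDr sqr_ge0.
- move=> m; have [nm|mn] := leP n m; last first.
    have -> : u m = 0%E.
      by rewrite /u (tpoly_fourier_eq0 Bt) ?(@normc0 R)//; lia.
    apply: adde_ge0; last exact: hankel_ge0.
    by rewrite lee_fin addr_ge0// mulr_ge0// ltW.
  have [s [us sP cA]] := fourier_mul_tpoly_le m cb At.
  have cAb : bmc (fun z => c z * A z) by exact: bmcM.
  have step : normc (fourier B m) <= delta + normc (fourier (fun z => c z * A z) m).
    have := relB m nm; rewrite fourierB//.
    set x := fourier _ m; set y := fourier B m => xy.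
    have -> : y = - (x - y) + x by ring.
    by apply: le_trans (le_normcD _ _) _; rewrite normcN lerD2r.
  apply: (@le_trans _ _ (delta + \sum_(k <- s) h (m - k) * normc (fourier A k))%:E).
    by rewrite lee_fin (le_trans step)// lerD2l.
  rewrite [c0 * _ + _]addrC !EFinD -addeA; apply: leeD => //.
  pose x k := h (m - k) * normc (fourier A k).
  have x0 k : 0 <= x k by rewrite mulr_ge0// normc_ge0.
  apply: (@le_trans _ _ (x 0 + \sum_(k <- [seq k <- s | k != 0]) x k)%:E).
    rewrite lee_fin big_filter; have [s0|s0] := boolP (0 \in s).
      by rewrite (bigD1_seq 0).
    rewrite -[leLHS]add0r lerD// [leRHS]big_mkcond [leLHS]big_seq [leRHS]big_seq.
    apply: ler_sum => k ks; case: eqP => // k0.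
    by move: s0; rewrite -k0 ks.
  rewrite EFinD; apply: leeD; first by rewrite lee_fin /x A0 subr0 mulrC.
  rewrite -sumEFin; apply: le_trans (sum_seq_le_esum
    (r := map -%R [seq k <- s | k != 0]) (a := fun j => ((h (m + j))%:E * v j)%E) _ _).
  + rewrite big_map [leLHS]big_seq [leRHS]big_seq; apply: lee_sum => k.
    rewrite mem_filter => /andP[k0 ks]; have := sP _ ks; rewrite /in_mem /= => kP.
    rewrite /v opprK ifT; last by lia.
    by rewrite /x EFinM.
  + by rewrite map_inj_uniq ?filter_uniq//; exact: oppr_inj.
  + by move=> k; rewrite mule_ge0// lee_fin.
- move=> j; rewrite /v; case: ifPn => j1; last first.
    by apply: adde_ge0; [rewrite lee_fin|exact: hankel_ge0].
  have BPc : tpoly (fun k => - (n + r.+1%:Z) < k <= - n) (fun z => conjc (B z)).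
    by apply: tpoly_conj Bt => k; lia.
  have [s [us sP cB]] := fourier_mul_tpoly_le j cb BPc.
  have cBb : bmc (fun z => c z * conjc (B z)) by exact: bmcM.
  have step : normc (fourier A (- j)) <=
      delta + normc (fourier (fun z => c z * conjc (B z)) j).
    have := relA j j1; rewrite fourierD//.
    rewrite fourier_conj// -[normc (fourier A _)]normc_conj.
    set x := conjc _; set y := fourier _ j => xy.
    have -> : x = (x + y) + - y by ring.
    by apply: le_trans (le_normcD _ _) _; rewrite normcN lerD2r.
  apply: (@le_trans _ _ (delta + \sum_(k <- s) h (j - k) * normc (fourier B (- k)))%:E).
    rewrite lee_fin (le_trans step)// lerD2l (le_trans cB)//.
    by apply: ler_sum => k _; rewrite fourier_conj// normc_conj.
  rewrite EFinD; apply: leeD => //.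
  rewrite -sumEFin.
  apply: le_trans (sum_seq_le_esum (r := map -%R s) (a := fun k => ((h (j + k))%:E * u k)%E) _ _).
  + rewrite big_map; apply: lee_sum => k _.
    by rewrite /u EFinM.
  + by rewrite map_inj_uniq//; exact: oppr_inj.
  + by move=> k; rewrite mule_ge0// lee_fin.
Qed.

End HankelInequalities.

(** * The bounded case *)

Section BoundedCase.
Variable R : realType.
Implicit Types (z u v : R[i]) (f g : R[i] -> R[i]) (w : int -> R) (F : int -> R[i]).

Lemma le_of_le_addM (x y C : R) : 0 <= C ->
  (forall eta, 0 < eta -> x <= y + C * eta) -> x <= y.
Proof.
move=> C0 H; apply/ler_addgt0Pr => e e0.
have C1 : 0 < C + 1 by rewrite ltr_wpDl.
apply: le_trans (H (e / (C + 1)) _) _; first by rewrite divr_gt0.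
by rewrite lerD2l mulrCA ler_piMr ?(ltW e0)// ler_pdivrMr// mul1r lerDl.
Qed.

(** A constant multiple of [b / a] is the limit of [p conj g] in [L^1], hence
    each coefficient converges, and finite sums of coefficients inherit the
    bound. *)
Lemma quotient_coefficients w (beta : R) a b c (G : R) (gamma : R[i]) (r : seq int) :
  even_weight w -> bmc a -> bmc b -> bmc c -> 0 <= beta -> 0 <= G ->
  (forall z, normc z = 1 -> c z * a z = b z) ->
  (forall z, normc z = 1 -> normc (c z) <= 1) -> normc gamma = 1 ->
  (forall eta, 0 < eta -> exists2 p, wpoly w beta xpredT p &
     rmean (fun z => normc (b z - p z)) <= eta) ->
  (forall eta, 0 < eta -> exists g,
   [/\ tpoly (fun k => 0 <= k) g,
    forall z, normc z = 1 -> normc (g z) <= G,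
    forall Q q, 0 <= Q -> wpoly w Q xpredT q ->
      wpoly w (Q * G) xpredT (fun z => q z * conjc (g z)) &
    rmean (fun z => normc (conjc (a z) * g z - gamma)) <= eta]) ->
  uniq r -> \sum_(k <- r) normc (fourier c k) * w k <= beta * G.
Proof.
move=> ww ab bb cb b0 G0 ca c1 gam1 bapp gapp ur.
have w0 k : 0 <= w k by case: ww => w1 _ _; exact: le_trans (w1 k).
apply: (@le_of_le_addM _ _ ((1 + G) * \sum_(k <- r) w k)).
  by rewrite mulr_ge0 ?addr_ge0//; apply: sumr_ge0 => k _.
move=> eta eta0.
have [p pw bp] := bapp eta eta0; have [g [gt gG gmul ag]] := gapp eta eta0.
have pgw := gmul _ _ b0 pw.
have pb : bmc p := bmc_tpoly (wpoly_tpoly ww pw).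
have gb : bmc g := bmc_tpoly gt; have gcb := bmc_conj gb.
have pgb : bmc (fun z => p z * conjc (g z)) by exact: bmcM.
pose d z := conjc gamma * c z - p z * conjc (g z).
have db : bmc d by apply: bmcB pgb; exact: bmcZ.
have cg1 : normc (conjc gamma) = 1 by rewrite normc_conj.
have agb : bmc (fun z => conjc (a z) * g z - gamma).
  by apply: bmcB (bmc_cst _); apply: bmcM gb; exact: bmc_conj.
have bpb : bmc (fun z => b z - p z) by exact: bmcB.
have d_le : rmean (fun z => normc (d z)) <= (1 + G) * eta.
  apply: le_trans (_ : _ <= rmean (fun z => normc (conjc (a z) * g z - gamma) +
      G * normc (b z - p z))) _; last first.
    rewrite rmeanD; [|exact: bmr_normc|by apply: bmrZ; exact: bmr_normc].
    by rewrite rmeanZ ?mulrDl ?mul1r ?lerD ?ler_wpM2l//; exact: bmr_normc.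
  apply: le_rmean; first exact: bmr_normc.
    by apply: bmrD; [exact: bmr_normc|apply: bmrZ; exact: bmr_normc].
  move=> z z1.
  have -> : d z = c z * (conjc gamma - conjc (g z) * a z) + (b z - p z) * conjc (g z).
    by rewrite /d -ca//; ring.
  apply: le_trans (le_normcD _ _) _; rewrite !normcM normc_conj; apply: lerD.
    rewrite -[X in _ * X]normc_conj conjcD conjcN conjcM !conjcK.
    by rewrite normcB mulrC [g z * _]mulrC ler_piMr ?normc_ge0// c1.
  by rewrite mulrC ler_wpM2r ?normc_ge0// gG.
apply: (@le_trans _ _ (\sum_(k <- r) (normc (fourier (fun z => p z * conjc (g z)) k) * w k +
   (1 + G) * eta * w k))).
  apply: ler_sum => k _; rewrite -mulrDl ler_wpM2r//.
  have -> : normc (fourier c k) = normc (fourier (fun z => conjc gamma * c z) k).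
    by rewrite fourierZ// normcM cg1 mul1r.
  rewrite (@fourier_ext _ _ (fun z => p z * conjc (g z) + d z)); last first.
    by move=> z _; rewrite /d; ring.
  rewrite fourierD//; apply: le_trans (le_normcD _ _) _; rewrite lerD2l.
  exact: le_trans (normc_fourier_le k db) d_le.
rewrite big_split /=; apply: lerD; first exact: wpoly_fourier_le ww ur pgw.
by rewrite -mulr_sumr mulrAC.
Qed.

Lemma l1w_normE w c : l1w_norm w c = wsum w (EFin \o (fun k => normc (c k))).
Proof. by apply: eq_esum => k _; rewrite EFinM muleC. Qed.

Lemma esum_int_le (f : int -> R) (x : \bar R) :
  (forall r : seq int, uniq r -> ((\sum_(k <- r) f k)%:E <= x)%E) ->
  (\esum_(k in [set: int]) (f k)%:E <= x)%E.
Proof.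
move=> H; apply: ge_ereal_sup => _ [X [finX _] <-].
rewrite fsbig_finite//= sumEFin; apply: H; exact: finmap.fset_uniq.
Qed.

Lemma pow_small (q e : R) : 0 <= q < 1 -> 0 < e -> exists K : nat, q ^+ K <= e.
Proof.
move=> /andP[q0 q1] e0.
have /cvgr_lt /(_ e e0) [K _ HK] : (fun n => q ^+ n) @ \oo --> (0 : R).
  by apply: cvg_expr; rewrite ger0_norm.
by exists K; apply: ltW; exact: (HK K (leqnn K)).
Qed.

Lemma index_split (n : int) (N : nat) : (`|n| <= N)%N ->
  exists r1 r2 : nat, n = - N%:Z + r1%:Z /\ (2 * N).+1 = (r1 + r2.+1)%N.
Proof.
by move=> nN; exists (absz (n + N%:Z)%R), (2 * N - absz (n + N%:Z)%R)%N; lia.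
Qed.

(** The estimate for representatives that satisfy the almost-everywhere
    relations everywhere. *)
Lemma nlft_bound_bounded F a b c w (beta : R) : even_weight w ->
  bmc a -> bmc b -> bmc c -> 0 <= beta -> beta ^+ 2 < 2^-1 ->
  (forall z, normc z = 1 -> normc (a z) ^+ 2 + normc (b z) ^+ 2 = 1) ->
  (forall z, normc z = 1 -> normc (b z) <= beta) ->
  (forall z, normc z = 1 -> c z * a z = b z) ->
  (forall n : int, n < 0 -> fourier (fun z => conjc (a z)) n = 0) ->
  normc (circ_int a) = expR (rmean (fun z => ln (normc (a z)))) ->
  (forall eta, 0 < eta -> exists2 p, wpoly w beta xpredT p &
     rmean (fun z => normc (b z - p z)) <= eta) ->
  (forall eta, 0 < eta -> exists N0 : nat, forall N, (N0 <= N)%N ->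
     rmean (fun z => normc ((su2_row F (- N%:Z) (2 * N).+1 z).1 - a z)) <= eta /\
     rmean (fun z => normc ((su2_row F (- N%:Z) (2 * N).+1 z).2 - b z)) <= eta) ->
  exists Q : R, [/\ l1w_norm w (fourier c) = Q%:E, 0 <= Q,
    (1 - 2 * beta ^+ 2) <= (1 - Q ^+ 2) &
    (l1w_norm w F <= (Q / (1 - Q ^+ 2))%:E)%E].
Proof.
move=> ww ab bb cb b0 b2 unit_ab b_le ca a_an a_out b_app trunc.
have [w1 _ _] := ww; have w0 k : 0 <= w k by exact: le_trans (w1 k).
pose G := (Num.sqrt (1 - beta ^+ 2))^-1.
have G0 : 0 <= G by rewrite invr_ge0 sqrtr_ge0.
have [gamma gam1 gapp] :=
  outer_inverse_approx ww b0 (ltW b2) ab bb unit_ab b_le a_an a_out b_app.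
have c1 z : normc z = 1 -> normc (c z) <= 1.
  move=> z1; have uz := unit_ab z z1; have bz := b_le z z1.
  have bz2 : normc (b z) ^+ 2 <= beta ^+ 2 by rewrite lerXn2r ?nnegrE ?normc_ge0.
  have cz : normc (c z) ^+ 2 * normc (a z) ^+ 2 = normc (b z) ^+ 2.
    by rewrite -exprMn -normcM ca.
  rewrite -(@expr_le1 _ 2) ?normc_ge0//.
  have a2 : 0 < normc (a z) ^+ 2 by lra.
  by rewrite -(ler_pM2r a2) cz mul1r; lra.
have csum r := quotient_coefficients (r := r) ww ab bb cb b0 G0 ca c1 gam1 b_app gapp.
have norm_c_le : (l1w_norm w (fourier c) <= (beta * G)%:E)%E.
  by apply: esum_int_le => r ur; rewrite lee_fin; exact: csum.
have norm_c0 : (0 <= l1w_norm w (fourier c))%E.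
  by apply: esum_ge0 => k _; rewrite lee_fin mulr_ge0// normc_ge0.
have norm_c_fin : l1w_norm w (fourier c) \is a fin_num.
  by rewrite ge0_fin_numE// (le_lt_trans norm_c_le)// ltry.
pose Q := fine (l1w_norm w (fourier c)).
have QE : l1w_norm w (fourier c) = Q%:E by rewrite /Q fineK.
have Q0 : 0 <= Q by rewrite fine_ge0.
have Q_le : Q <= beta * G by rewrite -lee_fin -QE.
have gap : 1 - 2 * beta ^+ 2 <= 1 - Q ^+ 2.
  have b1 : 0 < 1 - beta ^+ 2 by have := sqr_ge0 beta; lra.
  have Q2 : Q ^+ 2 <= beta ^+ 2 / (1 - beta ^+ 2).
    apply: le_trans (_ : _ <= (beta * G) ^+ 2) _.
      by rewrite lerXn2r ?nnegrE ?mulr_ge0.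
    by rewrite exprMn exprVn sqr_sqrtr// ltW.
  rewrite lerB// (le_trans Q2)// ler_pdivrMr//.
  by have := sqr_ge0 beta; nra.
exists Q; split=> //.
have Qlt1 : 0 <= Q < 1.
  rewrite Q0 /=; rewrite -(@expr_lt1 _ 2)//; lra.
have Q2 : 0 < 1 - Q ^+ 2 by lra.
pose h k := normc (fourier c k).
have h0 k : 0 <= h k by exact: normc_ge0.
have hw : (wsum w (EFin \o h) <= Q%:E)%E by rewrite -QE l1w_normE.
have hQ : (\esum_(k in [set: int]) (h k)%:E <= Q%:E)%E.
  apply: le_trans hw; apply: le_esum => k _ /=.
  by rewrite -EFinM lee_fin ler_peMl.
(* half of the limit of the constant coefficients of the truncated transforms:
   a lower bound for that of every right factor, once the truncation is long *)
pose a0 := normc (circ_int a) / 2.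
have a0_gt0 : 0 < a0 by rewrite divr_gt0// a_out expR_gt0.
have entry n K : ((normc (F n))%:E <= majorant h K n + (Q ^+ (2 * K) / a0)%:E)%E.
  apply/lee_addgt0Pr => e e0.
  pose delta := e * a0 * (1 - Q ^+ 2) / 2.
  have d0 : 0 < delta by rewrite divr_gt0// mulr_gt0// mulr_gt0.
  pose eta := Num.min (delta / (2 * (1 + G))) a0.
  have G1 : 0 < 2 * (1 + G) by lra.
  have eta0 : 0 < eta by rewrite lt_min divr_gt0.
  have eta_d : 2 * (1 + G) * eta <= delta.
    rewrite mulrC -ler_pdivlMr// /eta; by rewrite ge_min lexx.
  have [N0 HN] := trunc eta eta0.
  pose N := maxn N0 `|n|%N; have [Na Nb] := HN N (leq_maxl _ _).
  have nN : (`|n| <= N)%N by exact: leq_maxr.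
  have [r1 [r2 [r1E r2E]]] := index_split nN.
  have [g [gt gG _ ga]] := gapp eta eta0.
  have nE : n - r1%:Z = - N%:Z by rewrite r1E addrK.
  rewrite r2E -nE in Na Nb.
  have eta_a0 : eta <= a0 by rewrite ge_min lexx orbT.
  pose c0 := su2_mean F n r2.+1.
  have c0_ge : a0 <= c0.
    have /andP[m1 m2] := su2_mean_bounds F (n - r1%:Z) r1.
    have /andP[c0_gt0 _] := su2_mean_bounds F n r2.+1; rewrite -/c0 in c0_gt0.
    have tot : su2_mean F (n - r1%:Z) (r1 + r2.+1) <= c0.
      by rewrite su2_mean_cat subrK ler_piMl// ltW.
    apply: le_trans tot.
    have [aNt _] := su2_row_tpoly F (n - r1%:Z) (r1 + r2.+1).
    have aNb := bmc_tpoly aNt.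
    have := normc_circ_int_le (bmcB aNb ab); rewrite circ_intB// circ_int_su2_row.
    move=> /le_trans /(_ Na) /le_trans /(_ eta_a0) dist.
    have /andP[t0 _] := su2_mean_bounds F (n - r1%:Z) (r1 + r2.+1).
    have := le_trans (normc_sub_ge _ _) dist.
    rewrite normc_real (ger0_norm (ltW t0)) ler_norml => /andP[]; rewrite /a0; lra.
  have c0_gt0 : 0 < c0 by exact: lt_le_trans c0_ge.
  have [relB relA] := truncated_relations ab bb cb ca c1 gam1 gt G0 gG ga Na Nb.
  have relB' m : n <= m -> normc (fourier (fun z => c z * (su2_row F n r2.+1 z).1 -
      (su2_row F n r2.+1 z).2) m) <= delta.
    by move=> nm; exact: le_trans (relB m nm) eta_d.
  have relA' m : 1 <= m -> normc (fourier (fun z => conjc (su2_row F n r2.+1 z).1 +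
      c z * conjc (su2_row F n r2.+1 z).2) m) <= delta.
    by move=> nm; exact: le_trans (relA m nm) eta_d.
  have := truncated_bound K cb Qlt1 (ltW d0) hQ relB' relA'; rewrite -/c0 -/h.
  have E : 2 * delta / (1 - Q ^+ 2) = e * a0.
    by rewrite /delta; field; rewrite gt_eqF.
  rewrite E EFinM => main.
  have ci0 : (0 <= (c0^-1)%:E)%E by rewrite lee_fin invr_ge0 ltW.
  have M0 := majorant_ge0 K n h0.
  have cc : ((c0^-1)%:E * c0%:E = 1)%E by rewrite -EFinM mulVf// gt_eqF.
  have := lee_wpmul2l ci0 main.
  rewrite muleA cc mul1e => /le_trans; apply.
  have p0 : 0 <= Q ^+ (2 * K) + e * a0.
    by rewrite addr_ge0 ?exprn_ge0// mulr_ge0// ltW.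
  rewrite ge0_muleDr ?mule_ge0 ?lee_fin ?(ltW c0_gt0)//.
  rewrite muleA cc mul1e -addeA; apply: leeD => //.
  rewrite -EFinM -EFinD lee_fin.
  have -> : Q ^+ (2 * K) / a0 + e = a0^-1 * (Q ^+ (2 * K) + e * a0).
    by field; rewrite gt_eqF.
  by rewrite ler_wpM2r// lef_pV2.
rewrite /l1w_norm; apply: esum_int_le => r ur; clearbody a0.
pose C := (\sum_(k <- r) w k) / a0.
have C0 : 0 <= C by rewrite divr_ge0 ?(ltW a0_gt0)//; apply: sumr_ge0.
apply/lee_addgt0Pr => e e0.
have [K KP] : exists K, Q ^+ (2 * K) * C <= e.
  have q2 : 0 <= Q ^+ 2 < 1 by rewrite sqr_ge0 /=; lra.
  have [|K KP] := @pow_small (Q ^+ 2) (e / (C + 1)) q2.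
    by rewrite divr_gt0// ltr_wpDl.
  exists K; rewrite exprM; apply: le_trans (_ : _ <= (e / (C + 1)) * C) _.
    by rewrite ler_wpM2r.
  by rewrite mulrAC ler_pdivrMr ?ltr_wpDl// ler_wpM2l ?(ltW e0)// lerDl.
apply: (@le_trans _ _ (\sum_(k <- r)
    ((w k)%:E * majorant h K k + (w k * (Q ^+ (2 * K) / a0))%:E))%E).
  rewrite -sumEFin; apply: lee_sum => k _.
  have Mk := majorant_ge0 K k h0.
  have wk : (0 <= (w k)%:E)%E by rewrite lee_fin.
  have := lee_wpmul2l wk (entry k K).
  rewrite ge0_muleDr ?lee_fin ?divr_ge0 ?exprn_ge0 ?(ltW a0_gt0)//.
  by rewrite -!EFinM mulrC.
rewrite big_split /=; apply: leeD.
  apply: le_trans (wsum_majorant K ww h0 Qlt1 hw).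
  apply: sum_seq_le_esum ur _ => k; apply: mule_ge0; first by rewrite lee_fin.
  exact: majorant_ge0.
rewrite sumEFin lee_fin -mulr_suml; apply: le_trans KP.
by rewrite mulrCA.
Qed.

End BoundedCase.

(** * Reduction to the bounded case *)

Section Reduction.
Variable R : realType.
Implicit Types (z u v : R[i]) (f g : R[i] -> R[i]) (w : int -> R) (F : int -> R[i]).
Local Notation mu := (@lebesgue_measure R).
Local Notation dom := (circ_dom R).

Lemma fourier_ae f f' n : circ_measurable f -> circ_measurable f' ->
  ae_circ (fun z => f z = f' z) -> fourier f n = fourier f' n.
Proof.
move=> mf mf' ff; have mz := bmc_meas (@bmc_exprz R (- n)).
apply: circ_int_ae; [exact: circ_measM|exact: circ_measM|].
by apply: ae_circS ff => z _ ->.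
Qed.

Lemma L2_cvg_ext (U V : nat -> R[i] -> R[i]) f :
  (forall N z, normc z = 1 -> U N z = V N z) -> L2_cvg U f -> L2_cvg V f.
Proof.
move=> UV; rewrite /L2_cvg (_ : (fun N => L2sq (fun z => U N z - f z)) =
  (fun N => L2sq (fun z => V N z - f z)))//.
apply/funext => N; rewrite /L2sq; congr (_ * _)%E; apply: eq_integral => t _.
by rewrite UV// normc_expi.
Qed.

Lemma cstar_circle f z : normc z = 1 -> cstar f z = conjc (f z).
Proof. by move=> z1; rewrite /cstar (unit_conj z1) invrK. Qed.

(** At the origin the Herglotz kernel is 1, and the outer representation reduces
    to the extremal case of Jensen's inequality. *)
Lemma outer_at_origin f : outer f ->
  normc (fourier f 0) = expR (rmean (fun z => ln (normc (f z)))).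
Proof.
move=> [_ _ _ [u u1 H]].
have := H 0; rewrite (@normc0 R) => /(_ ltr01) cvg0.
set y := u * cexp (herglotz_log f 0) in cvg0.
have fy : fourier f 0 = y.
  apply/eqP; rewrite -subr_eq0; apply/eqP/eq0_normc/eqP.
  rewrite eq_le normc_ge0 andbT; apply/ler_addgt0Pr => e e0; rewrite add0r.
  have /cvgr_lt /(_ e e0) [N _ HN] := cvg0.
  have /= := HN N.+1 (leqnSn N); rewrite big_ord_recl expr0 mulr1 big1 ?addr0.
    exact: ltW.
  by move=> i _; rewrite /= expr0n mulr0.
rewrite fy /y normcM u1 mul1r /cexp normcM normc_real normc_expi mulr1.
rewrite ger0_norm ?expR_ge0//; congr expR; rewrite /herglotz_log circ_intE.
apply: rmean_ext => z z1; rewrite addr0 subr0 divff ?mul1r//.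
exact: unit_neq0.
Qed.

End Reduction.

Theorem proposition2 (R : realType) :
  exists C : R, 0 < C /\
    forall (F : int -> R[i]) (a b : R[i] -> R[i]) (w : int -> R) (eps : R),
      in_l2 F ->
      is_nlft F a b ->
      outer (cstar a) ->
      strong_beurling_weight w ->
      0 < eps ->
      (Aw_norm w b < ((Num.sqrt 2)^-1 - eps)%:E)%E ->
      (l1w_norm w F <= (C / eps)%:E * Aw_norm w (fun z => (b z / a z)%R))%E.
Proof.
exists 1; split=> // F a b w eps _ [aL2 bL2 Acvg Bcvg] a_outer [w1 wN wD _] eps0 b_small.
have ww : even_weight w by [].
have w0 k : 0 <= w k by exact: le_trans (w1 k).
rewrite [in X in (_ <= X)%E]/Aw_norm; case: asboolP => [cL2|_]; last first.
  by rewrite gt0_muley ?leey// lte_fin divr_gt0.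
have [am _] := aL2; have [bm _] := bL2; have [cm _] := cL2.
move: b_small; rewrite /Aw_norm asboolT// => b_small.
have b_norm0 : (0 <= l1w_norm w (fourier b))%E.
  by apply: esum_ge0 => k _; rewrite lee_fin mulr_ge0// normc_ge0.
have b_fin : l1w_norm w (fourier b) \is a fin_num.
  by rewrite ge0_fin_numE// (lt_trans b_small)// ltry.
pose beta := fine (l1w_norm w (fourier b)).
have betaE : l1w_norm w (fourier b) = beta%:E by rewrite fineK.
have beta0 : 0 <= beta by rewrite fine_ge0.
have beta_lt : beta < (Num.sqrt 2)^-1 - eps by rewrite -lte_fin -betaE.
have [beta2 gap] : beta ^+ 2 < 2^-1 /\ eps <= 1 - 2 * beta ^+ 2.
  have s2 : ((Num.sqrt 2)^-1 : R) ^+ 2 = 2^-1 by rewrite exprVn sqr_sqrtr.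
  have s0 : 0 <= (Num.sqrt 2)^-1 :> R by rewrite invr_ge0 sqrtr_ge0.
  move: beta_lt s2 s0; set s := (Num.sqrt 2)^-1 => beta_lt s2 s0.
  have sh : 2^-1 <= s by nra.
  by split; nra.
pose A N z := (su2_row F (- N%:Z) (2 * N).+1 z).1.
pose B N z := (su2_row F (- N%:Z) (2 * N).+1 z).2.
have {}Acvg : L2_cvg A a.
  by apply: L2_cvg_ext Acvg => N z z1; case: (nlft_trunc_row F N z1).
have {}Bcvg : L2_cvg B b.
  by apply: L2_cvg_ext Bcvg => N z z1; case: (nlft_trunc_row F N z1).
have At N : tpoly (fun k => - (2 * N).+1%:Z <= k <= 0) (A N).
  by have [] := su2_row_tpoly F (- N%:Z) (2 * N).+1.
have Bt N : tpoly (fun k => - N%:Z <= k < - N%:Z + (2 * N).+1%:Z) (B N).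
  by have [] := su2_row_tpoly F (- N%:Z) (2 * N).+1.
have Ab N : bmc (A N) := bmc_tpoly (At N).
have Bb N : bmc (B N) := bmc_tpoly (Bt N).
have unit_ae : ae_circ (fun z => normc (a z) ^+ 2 + normc (b z) ^+ 2 = 1).
  by apply: unit_pair_ae Ab Bb am bm _ Acvg Bcvg => N z; exact: su2_row_normc.
(* a first correction makes [b] bounded, which is what the bound by [beta] needs *)
pose good1 : pred R[i] := fun z => normc (a z) ^+ 2 + normc (b z) ^+ 2 == 1.
have mgood1 : measurable_fun (circ_dom R) (fun t => good1 (expi t)).
  apply: measurable_fun_eqr; last exact: measurable_cst.
  by apply: measurable_funD; [exact: rmeas_normc2 am|exact: rmeas_normc2 bm].
have b_coef f r : circ_measurable f -> ae_circ (fun z => b z = f z) -> uniq r ->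
    \sum_(k <- r) normc (fourier f k) * w k <= beta.
  move=> mf bf ur; rewrite -lee_fin -betaE -sumEFin.
  under eq_bigr => k _ do rewrite -(fourier_ae k bm mf bf).
  by apply: sum_seq_le_esum ur _ => k; rewrite lee_fin mulr_ge0// normc_ge0.
have b_app f : bmc f -> ae_circ (fun z => b z = f z) -> forall eta, 0 < eta ->
    exists2 p, wpoly w beta xpredT p & rmean (fun z => normc (f z - p z)) <= eta.
  move=> fb bf; apply: (fourier_approx ww fb Bt).
    by move=> r; apply: b_coef bf; exact: bmc_meas.
  exact: L2_cvg_rmean Bb bm fb bf Bcvg.
have b_le_ae : ae_circ (fun z => normc (b z) <= beta).
  have b1b : bmc (repair good1 0 b).
    apply: (@bmc_repair _ _ _ _ 1) => // z z1 /eqP gz.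
    by rewrite -(@expr_le1 _ 2) ?normc_ge0// -gz lerDr sqr_ge0.
  have bb1 : ae_circ (fun z => b z = repair good1 0 b z).
    by apply: ae_circS unit_ae => z _ E; rewrite /repair /good1 E eqxx.
  have := normc_bound_ae ww b1b (b_app _ b1b bb1).
  move=> /(ae_circI bb1); apply: ae_circS => z _ [<-//].
pose good : pred R[i] := fun z => good1 z && (normc (b z) <= beta).
have mgood : measurable_fun (circ_dom R) (fun t => good (expi t)).
  apply: measurable_and => //; apply: measurable_fun_ler; last exact: measurable_cst.
  exact: rmeas_normc bm.
have good_ae f u : ae_circ (fun z => f z = repair good u f z).
  have := ae_circI unit_ae b_le_ae; apply: ae_circS => z _ [E le_b].
  by rewrite /repair /good /good1 E eqxx le_b.
have goodP z : good z -> [/\ normc (a z) ^+ 2 + normc (b z) ^+ 2 = 1,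
    normc (b z) <= beta & 2^-1 <= normc (a z) ^+ 2].
  move=> /andP[/eqP E le_b]; split=> //.
  have : normc (b z) ^+ 2 <= beta ^+ 2 by rewrite lerXn2r ?nnegrE ?normc_ge0.
  by lra.
have good_neq0 z : good z -> a z != 0.
  move=> /goodP[_ _ a2]; apply/eqP => az; move: a2.
  by rewrite az (@normc0 R) expr0n /= => ?; lra.
pose a' := repair good 1 a; pose b' := repair good 0 b.
pose c' := repair good 0 (fun z => b z / a z).
have ab' : bmc a'.
  apply: (@bmc_repair _ _ _ _ 1) => // z z1 /goodP[E _ _].
  by rewrite -(@expr_le1 _ 2) ?normc_ge0// -E lerDl sqr_ge0.
have bb' : bmc b'.
  by apply: (@bmc_repair _ _ _ _ beta) => // z z1 /goodP[].
have cb' : bmc c'.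
  apply: (@bmc_repair _ _ _ _ 1) => // z z1 gz; have [E le_b a2] := goodP z gz.
  have a0 := good_neq0 z gz.
  have cz : normc (b z / a z) ^+ 2 * normc (a z) ^+ 2 = normc (b z) ^+ 2.
    by rewrite -exprMn -normcM divfK.
  rewrite -(@expr_le1 _ 2) ?normc_ge0// -(ler_pM2r (_ : 0 < normc (a z) ^+ 2)); last by lra.
  by rewrite cz mul1r; lra.
have aa' : ae_circ (fun z => a z = a' z) by exact: good_ae.
have ba' : ae_circ (fun z => b z = b' z) by exact: good_ae.
have am' := bmc_meas ab'; have bm' := bmc_meas bb'; have cm' := bmc_meas cb'.
have unit' z : normc z = 1 -> normc (a' z) ^+ 2 + normc (b' z) ^+ 2 = 1.
  move=> _; rewrite /a' /b' /repair; case: ifP => [/goodP[]//|_].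
  by rewrite (@normc0 R) (@normc1 R) expr1n expr0n addr0.
have b_le z : normc z = 1 -> normc (b' z) <= beta.
  by move=> _; rewrite /b' /repair; case: ifP => [/goodP[]//|_]; rewrite (@normc0 R).
have ca z : normc z = 1 -> c' z * a' z = b' z.
  move=> _; rewrite /a' /b' /c' /repair; case: ifP => [gz|_]; last by rewrite mul0r.
  by rewrite divfK// good_neq0.
have conj_ae : ae_circ (fun z => conjc (a z) = conjc (a' z)).
  by apply: ae_circS aa' => z _ ->.
have a_an (n : int) : n < 0 -> fourier (fun z => conjc (a' z)) n = 0.
  have [_ an _ _] := a_outer => n0.
  rewrite -(fourier_ae n (circ_meas_conj am) (circ_meas_conj am') conj_ae) -(an n n0).
  by apply: fourier_ext => z z1; rewrite cstar_circle.
have a_out : normc (circ_int a') = expR (rmean (fun z => ln (normc (a' z)))).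
  rewrite -fourier0 -(fourier_ae 0 am am' aa').
  have -> : rmean (fun z => ln (normc (a' z))) = rmean (fun z => ln (normc (cstar a z))).
    rewrite (@rmean_ext _ (fun z => ln (normc (cstar a z))) (fun z => ln (normc (a z)))).
      apply: rmean_ae; [| |by apply: ae_circS aa' => z _ ->].
        by apply: rmeas_comp; [exact: measurable_ln|exact: rmeas_normc].
      by apply: rmeas_comp; [exact: measurable_ln|exact: rmeas_normc].
    by move=> z z1; rewrite cstar_circle// normc_conj.
  rewrite -outer_at_origin// (@fourier_ext _ (cstar a) (fun z => conjc (a z))); last first.
    by move=> z z1; rewrite cstar_circle.
  rewrite (fourier_ae 0 (circ_meas_conj am) (circ_meas_conj am') conj_ae).
  by rewrite fourier_conj// oppr0 normc_conj (fourier_ae 0 am am' aa').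
have trunc eta : 0 < eta -> exists N0 : nat, forall N, (N0 <= N)%N ->
    rmean (fun z => normc (A N z - a' z)) <= eta /\
    rmean (fun z => normc (B N z - b' z)) <= eta.
  move=> eta0; have e20 := exprn_gt0 2 eta0.
  have [N1 H1] := L2_cvg_rmean Ab am ab' aa' Acvg e20.
  have [N2 H2] := L2_cvg_rmean Bb bm bb' ba' Bcvg e20.
  exists (maxn N1 N2) => N; rewrite geq_max => /andP[n1 n2].
  split; apply: rmean_normc_le (ltW eta0) _; [exact: bmcB|exact: H1|exact: bmcB|exact: H2].
have [Q [QE Q0 gapQ FQ]] := nlft_bound_bounded ww ab' bb' cb' beta0 beta2 unit' b_le ca
  a_an a_out (b_app _ bb' ba') trunc.
have -> : l1w_norm w (fourier (fun z => b z / a z)) = Q%:E.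
  rewrite -QE; apply: eq_esum => k _.
  by rewrite (fourier_ae k cm cm' (good_ae (fun z => b z / a z) 0)).
apply: le_trans FQ _; rewrite -EFinM lee_fin mul1r mulrC ler_wpM2r//.
by rewrite lef_pV2 ?posrE//; lra.
Qed.
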